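(* Let $a>0$, $\gamma+1>0$, $\alpha>0$, $\mu_0\ge\frac{\gamma+1}{\alpha}$, $q\ge0$, $p\ge0$, $A\in\mathbb{R}$ and $B>0$. Then the (two-sided) inequality $$\frac{B\cdot\Gamma\left(\mu-\frac{\gamma+1}{\alpha}\right)}{\Gamma(\mu)\,(q+x)^{\mu-\frac{\gamma+1}{\alpha}}}\le S(x,a,\gamma,\alpha,\mu)\le\frac{A\cdot\Gamma\left(\mu-\frac{\gamma+1}{\alpha}\right)}{\Gamma(\mu)\,(p+x)^{\mu-\frac{\gamma+1}{\alpha}}}\qquad( * )$$ holds for all $\mu>\mu_0$ and all $x>0$ if and only if $0\le p<a^{\alpha}\le q$, $A\ge A_p(a,\gamma,\alpha)$ and $0<B\le B_q(a,\gamma,\alpha)$, where $$A_p(a,\gamma,\alpha):=\sup_{x>0}e^{px}x^{\frac{\gamma+1}{\alpha}}f(x,a,\gamma,\alpha),\qquad B_q(a,\gamma,\alpha):=\inf_{x>0}e^{qx}x^{\frac{\gamma+1}{\alpha}}f(x,a,\gamma,\alpha).$$ In this case (for every $\mu>\mu_0$) both inequalities in $( * )$ are strict for all $x>0$, and if $p>0$ they are also strict at $x=0$. Moreover, $A_p(a,\gamma,\alpha)<+\infty$ if and only if $p<a^{\alpha}$, and $B_q(a,\gamma,\alpha)>0$ if and only if $q\ge a^{\alpha}$. If $a\ge1$, then $A_p(a,1,2)=B_q(a,1,2)=\frac12$ for all $q\ge a^2$ and $0\le p\le m(\infty,a)$; in particular, this is valid for all $p\in[0,a^2-a]$.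
   Context: For $a>0$, $\gamma\in\mathbb{R}$, $\alpha>0$: $f(x,a,\gamma,\alpha)=\sum_{k=0}^{\infty}(k+a)^{\gamma}e^{-(k+a)^{\alpha}x}$ for $x>0$, and for $\mu>\max\left\{\frac{\gamma+1}{\alpha},0\right\}$ and $x\ge0$, $S(x,a,\gamma,\alpha,\mu)=\sum_{k=0}^{\infty}\frac{(k+a)^{\gamma}}{((k+a)^{\alpha}+x)^{\mu}}$ (generalized Mathieu series). $\Gamma$ is the Euler gamma function. Definition of $m(\infty,a)$: it is a known result that for every $\mu>1$ and $a\ge1$ there exist positive constants $m(\mu,a)$ and $M(\mu,a)$ such that the inequality $$\frac{1}{2(\mu-1)(q+x)^{\mu-1}}\le\sum_{k=0}^{\infty}\frac{k+a}{((k+a)^2+x)^{\mu}}\le\frac{1}{2(\mu-1)(p+x)^{\mu-1}}$$ holds for every $x>0$ if and only if $0\le p\le m(\mu,a)$ and $q\ge M(\mu,a)$. For fixed $a\ge1$ the function $m(\mu,a)$ is decreasing and $M(\mu,a)$ is increasing in $\mu\in(1,+\infty)$; $m(\infty,a)$ and $M(\infty,a)$ denote their limits as $\mu\to+\infty$. It is known that for all $a\ge1$, $\mu>1$: $a^2-a<m(\infty,a)\le m(\mu,a)\le a^2-a+\frac16$ and $a^2-a+\frac14<M(\mu,a)<M(\infty,a)=a^2$. Hence, for $a\ge1$, the displayed inequality holds for all $\mu>1$ and all $x>0$ if and only if $0\le p\le m(\infty,a)$ and $q\ge a^2$. *)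

(* Defs.v *)
From HB Require Import structures.
From mathcomp Require Import all_boot all_order all_algebra.
From mathcomp Require Import all_classical all_reals all_analysis.
Set Implicit Arguments.
Unset Strict Implicit.
Unset Printing Implicit Defensive.
Import Order.TTheory GRing.Theory Num.Theory.
Import numFieldNormedType.Exports.
Local Open Scope classical_set_scope.
Local Open Scope ring_scope.

(* Euler's integral; it represents the Gamma function only for z > 0. *)
Definition Gamma (R : realType) (z : R) : R :=
  \int[@lebesgue_measure R]_(t in `]0, +oo[) (t `^ (z - 1) * expR (- t)).

(* The terms of the two series below are nonnegative for x >= 0, so the
   extended real sum is the usual sum, with value +oo in case of divergence. *)
Definition f_series (R : realType) (x a gamma alpha : R) : \bar R :=
  (\sum_(0 <= k <oo)
    ((k%:R + a) `^ gamma * expR (- ((k%:R + a) `^ alpha * x)))%:E)%E.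

Definition mathieu_S (R : realType) (x a gamma alpha mu : R) : \bar R :=
  (\sum_(0 <= k <oo)
    ((k%:R + a) `^ gamma / ((k%:R + a) `^ alpha + x) `^ mu)%:E)%E.

Definition A_ (R : realType) (p a gamma alpha : R) : \bar R :=
  ereal_sup [set ((expR (p * x) * x `^ ((gamma + 1) / alpha))%:E
                  * f_series x a gamma alpha)%E | x in `]0, +oo[].

Definition B_ (R : realType) (q a gamma alpha : R) : \bar R :=
  ereal_inf [set ((expR (q * x) * x `^ ((gamma + 1) / alpha))%:E
                  * f_series x a gamma alpha)%E | x in `]0, +oo[].

(* The common shape of the two bounds of S: (C, r) is (B, q) in the lower bound
   and (A, p) in the upper one. *)
Definition mathieu_bound (R : realType) (C r gamma alpha mu x : R) : R :=
  C * Gamma (mu - (gamma + 1) / alpha)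
    / (Gamma mu * (r + x) `^ (mu - (gamma + 1) / alpha)).

(* m and M are the optimal shifts in the two-sided estimate of the series
   \sum_k (k + a) / ((k + a)^2 + x)^mu, i.e. of S(x, a, 1, 2, mu).  The shifts p
   and q range over nonnegative reals, where the real powers are meaningful. *)
Definition sharp_shifts (R : realType) (mu a m M : R) : Prop :=
  [/\ 0 < m, 0 < M &
      forall p q : R, 0 <= p -> 0 <= q ->
        (forall x : R, 0 < x ->
          ((2 * (mu - 1) * (q + x) `^ (mu - 1))^-1%:E <= mathieu_S x a 1 2 mu)%E /\
          (mathieu_S x a 1 2 mu <= (2 * (mu - 1) * (p + x) `^ (mu - 1))^-1%:E)%E)
        <-> (0 <= p <= m /\ M <= q)].

(* For mu > 1 and a >= 1, sharp shifts exist, and the equivalence determines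
   them uniquely, so the default value 0 is not used in that range. *)
Definition m_shift (R : realType) (mu a : R) : R :=
  xget 0 [set m | exists M : R, sharp_shifts mu a m M].

Definition m_shift_infty (R : realType) (a : R) : R :=
  lim (m_shift mu a @[mu --> +oo]).

(* Main.v *)
(* Write b = (gamma+1)/alpha.  Tonelli and Euler's integral give
   Gamma(mu) S(x,mu) = \int_0^oo t^(mu-1) e^(-xt) f(t) dt, and the bounds are the
   same integral with f(t) replaced by C t^(-b) e^(-rt).  So the pointwise bounds
   B t^(-b) e^(-qt) <= f(t) <= A t^(-b) e^(-pt), which are what A_p <= A and
   B <= B_q mean, imply the inequalities for S, strictly because for large t the
   pointwise bounds hold with a factor 2 to spare.  Conversely, take mu = n and
   x = n/t: then (n/t)^n S(n/t,n) = \sum_k (k+a)^gamma (1 + (k+a)^alpha t/n)^(-n)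
   tends to f(t), while the rescaled bound tends to C t^(-b) e^(-rt).
   Finiteness of A_p and positivity of B_q reduce to f(t) being of order t^(-b)
   as t -> 0, and to its first term as t -> oo.  For (gamma,alpha) = (1,2),
   explicit telescoping sums give
   e^(-a^2 t) <= 2 t f(t) <= e^(-(a^2-a) t). *)

Require Import Defs.
From HB Require Import structures.
From mathcomp Require Import all_boot all_order all_algebra.
From mathcomp Require Import all_classical all_reals all_analysis.
From mathcomp Require Import measurable_realfun ring lra.
Import Order.TTheory GRing.Theory Num.Theory.
Import numFieldNormedType.Exports.
Set Implicit Arguments.
Unset Strict Implicit.
Unset Printing Implicit Defensive.
Local Open Scope classical_set_scope.
Local Open Scope ring_scope.

(** * Elementary inequalities *)

(** The two halves of the converse are not symmetric. Since e^(-y) <= (1 + y/n)^(-n), the rescaled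
    series dominates f term by term, and the upper half needs no exchange of limit and sum. The
    lower half does need one; as (1 + y/n)^(-n) decreases in n, the terms at n = b + 1 serve as a
    majorant. The exponent b + 1 recurs because the kernel x^gamma (1 + x^alpha t)^(-(b+1)) has an
    elementary primitive: one telescoping sum gives both the summability of the majorant and the
    upper bound of order t^(-b) for f. As gamma may be negative, x^gamma can be monotone in either
    direction, so neighbouring values are compared up to a constant factor. The limit of n^b Gamma(n
    - b) / Gamma(n) is obtained from convexity under the Gamma density, without Stirling's formula.
    Shifts up to m(oo, a) are reached through the same converse, which only samples large
    exponents. *)

Lemma ln_le_subr1 (R : realType) (y : R) : 0 < y -> ln y <= y - 1.
Proof.
move=> y0; have := @le_ln1Dx R (y - 1).
rewrite (addrC 1) subrK; apply.
by rewrite ltrBrDr addNr.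
Qed.

(** Bernoulli's inequality for real exponents: y^b = y e^((b-1) ln y) and ln y >= 1 - 1/y, so y^b >=
    y + (b - 1)(y - 1). *)
Lemma powR_ge_tangent (R : realType) (y b : R) : 0 < y -> 1 <= b ->
  1 + b * (y - 1) <= y `^ b.
Proof.
move=> y0 b1.
have yE : y `^ b = y * expR ((b - 1) * ln y).
  by rewrite /powR gt_eqF// -{2}(lnK y0) -expRD; congr expR; ring.
have : 1 + (b - 1) * (1 - y^-1) <= expR ((b - 1) * ln y).
  apply: le_trans (expR_ge1Dx _); rewrite lerD2l ler_wpM2l ?subr_ge0//.
  have y'0 : 0 < y^-1 by rewrite invr_gt0.
  have := ln_le_subr1 y'0.
  rewrite lnV//; lra.
move=> /(ler_wpM2l (ltW y0)); rewrite -yE; apply: le_trans.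
have := mulfV (lt0r_neq0 y0); nra.
Qed.

Lemma powRN_ge_tangent (R : realType) (y b : R) : 0 < y -> 0 <= b ->
  1 - b * (y - 1) <= y `^ (- b).
Proof.
move=> y0 b0; rewrite /powR gt_eqF//; apply: le_trans (expR_ge1Dx _).
by rewrite mulNr lerD2l lerN2 ler_wpM2l// ln_le_subr1.
Qed.

(** Bernoulli with exponent n/m gives 1 + y/m <= (1 + y/n)^(n/m). This monotonicity supplies the
    majorant when limit and sum are exchanged. *)
Lemma powRN_1Ddiv_le (R : realType) (y m n : R) : 0 <= y -> 0 < m -> m <= n ->
  (1 + y / n) `^ (- n) <= (1 + y / m) `^ (- m).
Proof.
move=> y0 m0 mn; have n0 : 0 < n by exact: lt_le_trans mn.
have pn : 0 < 1 + y / n by rewrite ltr_wpDr// divr_ge0// ltW.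
have pm : 0 < 1 + y / m by rewrite ltr_wpDr// divr_ge0// ltW.
rewrite 2!powRN lef_pV2 ?posrE ?powR_gt0//.
have nE : n = (n / m) * m by rewrite divfK// gt_eqF.
rewrite [in leRHS]nE powRrM -nE.
apply: ge0_ler_powR; rewrite ?nnegrE ?powR_ge0 ?(ltW m0) ?(ltW pm)//.
have : 1 <= n / m by rewrite ler_pdivlMr// mul1r.
move=> /(powR_ge_tangent pn); apply: le_trans.
rewrite lerD2l addrC addKr.
suff -> : n / m * (y / n) = y / m by [].
by field; rewrite !gt_eqF.
Qed.

Lemma expRN_le_powRN (R : realType) (y m : R) : 0 <= y -> 0 < m ->
  expR (- y) <= (1 + y / m) `^ (- m).
Proof.
move=> y0 m0; have pm : 0 < 1 + y / m by rewrite ltr_wpDr// divr_ge0// ltW.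
rewrite /powR gt_eqF// ler_expR mulNr lerN2.
have := ln_le_subr1 pm; rewrite (addrC 1) addrK.
by move=> /(ler_wpM2l (ltW m0)); rewrite mulrCA divff ?gt_eqF// mulr1.
Qed.

(** Squeeze from 1 - 1/u <= ln u <= u - 1 at u = 1 + y/n. The shift [c] is b for the bounds of S and
    0 for its terms. *)
Lemma cvg_powRN_1Ddiv (R : realType) (y c : R) : 0 <= y ->
  (1 + y / n%:R) `^ (- (n%:R - c)) @[n --> \oo] --> expR (- y).
Proof.
move=> y0.
have ninf : (n%:R : R)^-1 @[n --> \oo] --> (0 : R).
  apply/gtr0_cvgV0; last exact: cvgr_idn.
  by near=> n; rewrite ltr0n; near: n; exists 1%N.
have aff (k : R) : (1 + k * n%:R^-1) @[n --> \oo] --> (1 : R).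
  have : (1 + k * n%:R^-1) @[n --> \oo] --> 1 + k * 0.
    by apply: cvgD; [exact: cvg_cst|exact: cvgMr].
  by rewrite mulr0 addr0.
have nc1 : (1 - c * n%:R^-1) @[n --> \oo] --> (1 : R).
  by under eq_fun do rewrite -mulNr; exact: aff.
have ny1 := aff y.
have lo : expR (- y * (1 - c * n%:R^-1)) @[n --> \oo] --> expR (- y).
  apply: continuous_cvg; first exact: continuous_expR.
  by rewrite -[X in _ --> X]mulr1; exact: cvgMr.
have hi : expR (- y * (1 - c * n%:R^-1) / (1 + y * n%:R^-1)) @[n --> \oo] --> expR (- y).
  apply: continuous_cvg; first exact: continuous_expR.
  have : - y * (1 - c / n%:R) / (1 + y / n%:R) @[n --> \oo] --> - y * 1 / 1.
    by apply: cvgM; [exact: cvgMr|apply: cvgV; rewrite ?oner_eq0].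
  by rewrite divr1 mulr1.
apply: squeeze_cvgr lo hi.
near=> n.
have n0 : (0 : R) < n%:R by near: n; exact: nbhs_infty_gtr.
have nc : c < n%:R by near: n; exact: nbhs_infty_gtr.
have pn : 0 < 1 + y / n%:R by rewrite ltr_wpDr// divr_ge0// ltW.
have nE : 1 - c / n%:R = (n%:R - c) / n%:R by rewrite mulrBl divff ?gt_eqF.
rewrite /powR gt_eqF// !ler_expR nE; apply/andP; split.
- rewrite !mulNr lerN2 mulrCA ler_wpM2l ?subr_ge0 ?(ltW nc)//.
  by have := ln_le_subr1 pn; rewrite [1 + _ in leRHS]addrC addrK.
- rewrite !mulNr lerN2 mulrCA -mulrA ler_wpM2l ?subr_ge0 ?(ltW nc)//.
  have pi0 : 0 < (1 + y / n%:R)^-1 by rewrite invr_gt0.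
  have := ln_le_subr1 pi0; rewrite lnV//.
  have := mulVf (lt0r_neq0 pn); set z := y / _; set w := _^-1 => h.
  by move=> h2; lra.
Unshelve. all: end_near. Qed.

Lemma expR_sub_ge (R : realType) (y : R) : 0 <= y ->
  2 * y <= expR y - expR (- y).
Proof.
move=> y0.
pose f (x : R^o) : R^o := expR x - expR (- x) - 2 * x.
have df (x : R^o) : is_derive x 1 f (expR x + expR (- x) - 2).
  apply: is_derive_eq; rewrite /GRing.scale/=; ring.
have h : f 0 <= f y.
  apply: (@ger0_derive1_ndecry R f 0) => //.
  - move=> x _. rewrite derive1E derive_val.
    have := expR_ge1Dx x; have := expR_ge1Dx (- x); lra.
  - by apply: derivable_within_continuous => x _.
by move: h; rewrite /f oppr0 expR0 mulr0; lra.
Qed.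

(** For w < 1 this says e^(2w) <= (1 + w)/(1 - w). The product form also makes sense for w >= 1,
    which occurs when it is used along an unbounded sequence. *)
Lemma expR2_bound (R : realType) (w : R) : 0 <= w ->
  (1 - w) * expR (2 * w) <= 1 + w.
Proof.
move=> w0.
pose f (x : R^o) : R^o := 1 + x - (1 - x) * expR (2 * x).
have df (x : R^o) : is_derive x 1 f (1 - (1 - 2 * x) * expR (2 * x)).
  apply: is_derive_eq; rewrite /GRing.scale/=; ring.
have h : f 0 <= f w.
  apply: (@ger0_derive1_ndecry R f 0) => //.
  - move=> x _. rewrite derive1E derive_val subr_ge0.
    have := expR_ge1Dx (- (2 * x)); rewrite expRN.
    rewrite -ler_pdivlMr ?expR_gt0// mul1r; lra.
  - by apply: derivable_within_continuous => x _.
by move: h; rewrite /f mulr0 expR0; lra.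
Qed.

(** * The Gamma function *)

Lemma powRB1M (R : realType) (x p : R) : 0 < x -> x `^ (p - 1) * x = x `^ p.
Proof.
move=> x0; have -> : x `^ p = x `^ (p - 1 + 1) by rewrite subrK.
rewrite [RHS]powRD; last by rewrite (gt_eqF x0) implybT.
by rewrite powRr1// ltW.
Qed.

(** Monotone convergence. Integrands t^(z-1) e^(-t) may be singular at 0, so substitution and the
    fundamental theorem are applied on closed half-lines away from 0. The parameter [c] makes the
    family stable under the scaling t -> c t. *)
Lemma cvg_integral_oy_exhaustion (R : realType) (g : R -> \bar R) (c : R) : 0 < c ->
  measurable_fun (`]0, +oo[ : set R) g -> (forall t : R, (0 < t)%R -> 0 <= g t)%E ->
  (\int[lebesgue_measure]_(t in `[(c / n.+1%:R)%R, +oo[) g t)%E @[n --> \oo]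
    --> (\int[lebesgue_measure]_(t in `]0%R, +oo[) g t)%E.
Proof.
move=> c0 mg g0.
have cn n : 0 < c / n.+1%:R by rewrite divr_gt0.
have sub n : (`[c / n.+1%:R, +oo[ : set R) `<=` (`]0, +oo[ : set R).
  by move=> t /=; rewrite !in_itv/= !andbT; exact: lt_le_trans.
have -> : `]0, +oo[%classic = \bigcup_n `[c / n.+1%:R, +oo[%classic :> set R.
  apply/seteqP; split => [t|t [n _]]; last exact: sub.
  rewrite /= in_itv/= andbT => t0; exists (Num.truncn (c / t)) => //=.
  rewrite in_itv/= andbT ler_pdivrMr// mulrC -ler_pdivrMr//.
  by rewrite ltW// truncnS_gt.
apply: ge0_nondecreasing_set_cvg_integral => //.
- move=> m n mn; apply/subsetPset => t /=; rewrite !in_itv/= !andbT.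
  apply: le_trans; rewrite ler_pM2l// lef_pV2 ?posrE// ler_nat//.
- by move=> n; exact: measurable_funS (sub n) mg.
- by move=> n t /sub /=; rewrite in_itv/= andbT => /g0.
Qed.

Lemma measurable_gamma_integrand (R : realType) (z c : R) (D : set R) :
  measurable_fun D (fun t : R => t `^ (z - 1) * expR (- (c * t))).
Proof.
apply: (@measurable_funS _ _ _ _ setT) => //.
apply: measurable_funM; first exact: measurable_powR.
by apply: measurableT_comp => //; apply: measurableT_comp => //; exact: measurable_funM.
Qed.

(** The substitution s = c t carries [1/(n+1), +oo[ onto [c/(n+1), +oo[. Both families exhaust ]0,
    +oo[, so the identity passes to the limit. *)
Lemma gamma_integral_scale (R : realType) (z c : R) : 0 < c ->
  (\int[lebesgue_measure]_(t in `]0%R, +oo[) (t `^ (z - 1) * expR (- (c * t)))%:E =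
   (c `^ (- z))%:E * \int[lebesgue_measure]_(t in `]0%R, +oo[) (t `^ (z - 1) * expR (- (1
     * t)))%:E)%E.
Proof.
move=> c0.
set f := fun c t : R => (t `^ (z - 1) * expR (- (c * t)))%:E.
have mf k (D : set R) : measurable_fun D (f k) by apply: measurableT_comp => //;
  exact: measurable_gamma_integrand.
have f0 k t : (0 <= f k t)%E by rewrite lee_fin mulr_ge0 ?powR_ge0 ?expR_ge0.
have := @cvg_integral_oy_exhaustion R (f c) 1 ltr01 (mf _ _) (fun t _ => f0 c t).
have /(@cvgeZl _ _ R _ _ (c `^ (- z))%:E isT) :=
  @cvg_integral_oy_exhaustion R (f 1) c c0 (mf _ _) (fun t _ => f0 1 t).
move=> /[swap] h1 h2; apply: (cvg_unique _ h1) => //.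
suff : forall n, (\int[lebesgue_measure]_(t in `[(1 / n.+1%:R)%R, +oo[) f c t =
  (c `^ (- z))%:E * \int[lebesgue_measure]_(t in `[(c / n.+1%:R)%R, +oo[) f 1%R t)%E.
  by move=> /funext h; rewrite /mkset h; exact: h2.
move=> n {h1 h2}.
pose F (t : R) := c * t.
have dF (t : R) : is_derive t 1 F c.
  by apply: is_derive_eq; rewrite /GRing.scale/= mulr1.
have dFE : F^`()%classic = cst c by apply/funext => t; rewrite derive1E derive_val.
have cF : continuous F by move=> t; apply: continuousM; [exact: cvg_cst|exact: cvg_id].
have -> : c / n.+1%:R = F (1 / n.+1%:R) by rewrite /F mul1r.
have a0 : 0 < 1 / n.+1%:R :> R by rewrite divr_gt0.
set a := 1 / _ in a0 *.
rewrite (@increasing_ge0_integration_by_substitutiony R F (fun t => t `^ (z - 1) * expR (- (1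
  * t)))).
- transitivity ((c `^ (- z))%:E * \int[lebesgue_measure]_(t in `[a, +oo[) ((c `^ z)%:E * f c t))%E.
    rewrite ge0_integralZl_EFin ?powR_ge0//; last first.
      exact: mf.
    by rewrite muleA -EFinM powRN mulVf ?mul1e// gt_eqF ?powR_gt0.
  congr (_ * _)%E; apply: eq_integral => t; rewrite inE/= in_itv/= andbT => at_.
  have t0 : (0 : R) < t := lt_le_trans a0 at_.
  rewrite dFE /f -EFinM; congr EFin; rewrite fctE /= mul1r /F.
  rewrite -(powRB1M z c0).
  by rewrite powRM ?ltW//; ring.
- by move=> s t _ _ st; rewrite ltr_pM2l.
- by rewrite dFE => t _; exact: cvg_cst.
- by rewrite dFE; exact: is_cvg_cst.
- by rewrite dFE; exact: is_cvg_cst.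
- split; first by move=> t _.
  by apply: cvg_at_right_filter; exact: cF.
- apply/cvgryPge => A; near=> t; rewrite /F -ler_pdivrMl//.
- apply: derivable_within_continuous => t; rewrite in_itv/= andbT => at_.
  have t0 : 0 < t by apply: lt_le_trans at_; rewrite mulr_gt0.
  apply: derivableM.
    by apply: derivable_powR; rewrite in_itv/= andbT.
  apply: ex_derive.
- by move=> t _; rewrite mulr_ge0 ?powR_ge0 ?expR_ge0.
Unshelve. all: end_near. Qed.

Lemma powR_expRN_le (R : realType) (z : R) : 0 < z ->
  exists2 C, 0 < C & forall t : R, 0 < t -> t `^ z * expR (- t) <= C * expR (- (t / 2)).
Proof.
(* The maximum of t^z e^(-t/2), attained at t = 2z; hence ln s <= s - 1 is used at s = t / (2z). *)
move=> z0; exists (expR (z * ln (2 * z) - z)); first exact: expR_gt0.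
move=> t t0; rewrite /powR gt_eqF// -!expRD ler_expR.
have tz : 0 < t / (2 * z) by rewrite divr_gt0// mulr_gt0.
have := ln_le_subr1 tz; rewrite ln_div ?posrE// ?mulr_gt0//.
move=> /(ler_wpM2l (ltW z0)).
have -> : z * (t / (2 * z) - 1) = t / 2 - z by field; rewrite gt_eqF.
rewrite mulrBr; lra.
Qed.

Lemma cvg_expRN_half (R : realType) (C : R) : C * expR (- (t / 2)) @[t --> +oo] --> 0.
Proof.
rewrite -[X in _ --> X](mulr0 C); apply: cvgMr.
apply: (@cvg_comp _ _ _ (fun t : R => t / 2) (fun t => expR (- t))); last exact: cvgr_expR.
apply/cvgryPge => A; near=> t; rewrite ler_pdivlMr//.
Unshelve. all: end_near. Qed.

Lemma integral_itvcy_primitive (R : realType) (f F : R -> R) (a l : R) : 0 < a ->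
  (forall t, 0 < t -> 0 <= f t) ->
  (forall t : R, 0 < t -> {for t, continuous f}) ->
  (forall t : R, 0 < t -> is_derive t 1 F (f t)) ->
  F t @[t --> +oo] --> l ->
  (\int[lebesgue_measure]_(t in `[a, +oo[) (f t)%:E = (l - F a)%:E)%E.
Proof.
move=> a0 f0 cf dF Fl.
rewrite (@ge0_continuous_FTC2y R f F a l) ?EFinB//.
- by move=> t /(lt_le_trans a0); exact: f0.
- apply/continuous_within_itvcyP; split => [t|].
    by rewrite in_itv/= andbT => /(lt_trans a0); exact: cf.
  by apply: cvg_at_right_filter; exact: cf.
- by move=> t /(lt_trans a0) /dF ?; exact: ex_derive.
- apply: cvg_at_right_filter; apply: differentiable_continuous.
  by apply/derivable1_diffP; have ? := dF _ a0; exact: ex_derive.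
- move=> t; rewrite in_itv/= andbT => /(lt_trans a0) /dF ?.
  by rewrite derive1E derive_val.
Qed.

Lemma continuous_gamma_integrand (R : realType) (z t : R) : 0 < t ->
  {for t, continuous (fun t : R => t `^ z * expR (- t))}.
Proof.
move=> t0; apply: continuousM.
  apply: differentiable_continuous; apply/derivable1_diffP.
  by apply: derivable_powR; rewrite in_itv/= andbT.
by apply: continuous_comp; [exact: continuousN|exact: continuous_expR].
Qed.

(* Adding C e^(-t/2) to the derivative of t^z e^(-t) makes it nonnegative, as
   the fundamental theorem on a half-line requires. *)
Lemma gamma_integral_cut_rec (R : realType) (z C a : R) : 0 < z -> 0 < a ->
  (forall t : R, 0 < t -> t `^ z * expR (- t) <= C * expR (- (t / 2))) ->
  (\int[lebesgue_measure]_(t in `[a, +oo[) (t `^ z * expR (- t))%:E =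
   (a `^ z * expR (- a))%:E +
   z%:E * \int[lebesgue_measure]_(t in `[a, +oo[) (t `^ (z - 1) * expR (- t))%:E)%E /\
  (\int[lebesgue_measure]_(t in `[a, +oo[) (t `^ z * expR (- t))%:E <=
  (2 * C)%:E)%E.
Proof.
move=> z0 a0 bC.
have C0 : 0 <= C.
  have := le_trans (mulr_ge0 (powR_ge0 a z) (expR_ge0 (- a))) (bC _ a0).
  by rewrite pmulr_lge0 ?expR_gt0.
pose u (w t : R) := t `^ w * expR (- t).
pose h (t : R) := C * expR (- (t / 2)).
have u0 w t : 0 <= u w t by rewrite mulr_ge0 ?powR_ge0 ?expR_ge0.
have h0 t : 0 <= h t by rewrite mulr_ge0 ?expR_ge0.
have mu_ w (D : set R) : measurable_fun D (u w).
  apply: (@measurable_funS _ _ _ _ setT) => //.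
  apply: measurable_funM; first exact: measurable_powR.
  by apply: measurableT_comp => //; exact: measurableT_comp.
have mh (D : set R) : measurable_fun D h.
  apply: (@measurable_funS _ _ _ _ setT) => //.
  apply: measurable_funM; first exact: measurable_cst.
  by apply: measurableT_comp => //; apply: measurableT_comp => //; exact: measurable_funM.
have emu w (D : set R) : measurable_fun D (fun t : R => (u w t)%:E).
  by apply: measurableT_comp => //; exact: mu_.
have emh (D : set R) : measurable_fun D (fun t : R => (h t)%:E).
  by apply: measurableT_comp => //; exact: mh.
have dh (t : R) : is_derive t 1 (fun t => - (2 * C) * expR (- (t / 2)) : R) (h t).
  by apply: is_derive_eq; rewrite /GRing.scale/= /h; field.
have du (t : R) : 0 < t -> is_derive t 1 (u z) (z * u (z - 1) t - u z t).
  move=> t0; have ? := is_derive1_powR z t0.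
  by apply: is_derive_eq; rewrite /GRing.scale/= /u; ring.
have ch (t : R) : {for t, continuous h}.
  apply: continuousM; first exact: cvg_cst.
  apply: continuous_comp; last exact: continuous_expR.
  by apply: continuousN; apply: continuousM; [exact: cvg_id|exact: cvg_cst].
have E1 : (\int[lebesgue_measure]_(t in `[a, +oo[) (h t)%:E = (2 * C * expR (- (a / 2)))%:E)%E.
  rewrite (@integral_itvcy_primitive R h (fun t => - (2 * C) * expR (- (t / 2))) a 0)//.
    by congr EFin; ring.
  exact: cvg_expRN_half.
pose F (t : R) : R := - (2 * C) * expR (- (t / 2)) + u z t.
pose G (t : R) : R := h t + z * u (z - 1) t - u z t.
have G0 t : 0 < t -> 0 <= G t.
  by move=> t0; rewrite /G addrAC addr_ge0 ?subr_ge0 ?bC// mulr_ge0// ltW.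
have cG (t : R) : 0 < t -> {for t, continuous G}.
  move=> t0; apply: continuousB; last exact: continuous_gamma_integrand.
  apply: continuousD; first exact: ch.
  by apply: continuousM; [exact: cvg_cst|exact: continuous_gamma_integrand].
have dF (t : R) : 0 < t -> is_derive t 1 F (G t).
  move=> t0; have ? := du _ t0; have ? := dh t.
  by rewrite /G -addrA; exact: is_deriveD.
have F0 : F t @[t --> +oo] --> 0.
  rewrite -[X in _ --> X](addr0 0); apply: cvgD; first exact: cvg_expRN_half.
  apply: (@squeeze_cvgr _ _ _ _ (fun=> 0) (fun t => C * expR (- (t / 2)))).
  - by near=> t; rewrite u0 bC.
  - exact: cvg_cst.
  - exact: cvg_expRN_half.
have E2 : (\int[lebesgue_measure]_(t in `[a, +oo[) (G t)%:E =
    (2 * C * expR (- (a / 2)) - u z a)%:E)%E.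
  by rewrite (integral_itvcy_primitive a0 G0 cG dF F0) /F; congr EFin; ring.
have I2C : (\int[lebesgue_measure]_(t in `[a, +oo[) (u z t)%:E <= (2 * C * expR (- (a / 2)))%:E)%E.
  rewrite -E1; apply: ge0_le_integral => //.
  - by move=> t _; rewrite lee_fin.
  - exact: emu.
  - exact: emh.
  - by move=> t /=; rewrite in_itv/= andbT => /(lt_le_trans a0) t0; rewrite lee_fin bC.
split; last first.
  apply: (le_trans I2C); rewrite lee_fin ler_piMr ?mulr_ge0//.
  by rewrite expR_le1; lra.
have : (\int[lebesgue_measure]_(t in `[a, +oo[) ((G t)%:E + (u z t)%:E) =
  \int[lebesgue_measure]_(t in `[a, +oo[) ((h t)%:E + z%:E * (u (z - 1) t)%:E))%E.
  by apply: eq_integral => t _; rewrite -EFinM -!EFinD; rewrite /G; congr EFin; ring.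
rewrite ge0_integralD//; first last.
- exact: emu.
- by move=> t _; rewrite lee_fin.
- apply: measurableT_comp => //; apply: measurable_funB; last exact: mu_.
  apply: measurable_funD; first exact: mh.
  by apply: measurable_funM => //; exact: mu_.
- move=> t /=; rewrite in_itv/= andbT => /(lt_le_trans a0) t0.
  by rewrite lee_fin G0.
rewrite ge0_integralD//; first last.
- by apply: measurable_funeM; exact: emu.
- by move=> t _; rewrite mule_ge0// lee_fin// ltW.
- exact: emh.
- by move=> t _; rewrite lee_fin.
rewrite ge0_integralZl_EFin//; first last.
- exact: ltW.
- exact: emu.
- by move=> t _; rewrite lee_fin.
rewrite E1 E2 EFinB.
have : (0 <= \int[lebesgue_measure]_(t in `[a, +oo[) (u z t)%:E)%E.
  by apply: integral_ge0 => t _; rewrite lee_fin.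
have : (0 <= \int[lebesgue_measure]_(t in `[a, +oo[) (u (z - 1) t)%:E)%E.
  by apply: integral_ge0 => t _; rewrite lee_fin.
have -> : (a `^ z * expR (- a)) = u z a by [].
rewrite -/(u z) -/(u (z - 1)).
move: I2C; set I := integral _ _ _; set J := integral _ _ _.
clearbody I J => I2C J0 I0.
(* Cancelling in the extended reals requires finite integrals: [I] is bounded by [I2C], and an
   infinite [J] would make just one side of the equation infinite. *)
case: I I2C I0 => [r| |]; [|by rewrite leye_eq|by []].
case: J J0 => [s| |]; [|by rewrite gt0_muley ?lte_fin|by []].
by rewrite -!EFinM -!EFinD => _ _ _ [] e; congr EFin; move: e; lra.
Unshelve. all: end_near. Qed.

(** Limit of the recursion on [1/(n+1), +oo[: the boundary term a^z e^(-a) vanishes as a -> 0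
    because z > 0, and the bound 2C does not depend on the cut. *)
Lemma gamma_integral_rec_lty (R : realType) (z : R) : 0 < z ->
  (\int[lebesgue_measure]_(t in `]0%R, +oo[) (t `^ z * expR (- t))%:E =
   z%:E * \int[lebesgue_measure]_(t in `]0%R, +oo[) (t `^ (z - 1) * expR (- t))%:E)%E /\
  (\int[lebesgue_measure]_(t in `]0%R, +oo[) (t `^ z * expR (- t))%:E < +oo)%E.
Proof.
move=> z0; have [C C0 bC] := powR_expRN_le z0.
pose u (w t : R) := t `^ w * expR (- t).
have u0 w t : (0 <= (u w t)%:E)%E by rewrite lee_fin mulr_ge0 ?powR_ge0 ?expR_ge0.
have emu w (D : set R) : measurable_fun D (fun t : R => (u w t)%:E).
  apply: measurableT_comp => //.
  apply: (@measurable_funS _ _ _ _ setT) => //.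
  apply: measurable_funM; first exact: measurable_powR.
  by apply: measurableT_comp => //; exact: measurableT_comp.
have a0 n : 0 < 1 / n.+1%:R :> R by rewrite divr_gt0.
have cI w := @cvg_integral_oy_exhaustion R (fun t => (u w t)%:E) 1 ltr01 (emu _ _) (fun t _ => u0
  w t).
have cut n := gamma_integral_cut_rec z0 (a0 n) bC.
have c0 : ((1 / n.+1%:R) `^ z * expR (- (1 / n.+1%:R)))%:E @[n --> \oo] --> (0%:E : \bar R).
  apply: cvg_EFin; first exact: nearW.
  have h0 : (1 / n.+1%:R : R) @[n --> \oo] --> 0.
    by under eq_fun do rewrite div1r; exact: cvg_harmonic.
  rewrite /= -[X in _ --> X](mul0r (expR (- 0))); apply: cvgM.
    by have /cvg_at_rightP := powR_cvg0 z0; apply.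
  apply: continuous_cvg; first exact: continuous_expR.
  exact: cvgN.
split.
  apply: (cvg_unique _ (cI z)) => //=.
  have e : (fun n => \int[lebesgue_measure]_(t in `[(1 / n.+1%:R)%R, +oo[) (u z t)%:E)%E =
    (fun n => ((1 / n.+1%:R) `^ z * expR (- (1 / n.+1%:R)))%:E +
       z%:E * \int[lebesgue_measure]_(t in `[(1 / n.+1%:R)%R, +oo[) (u (z - 1) t)%:E)%E.
    by apply/funext => n; rewrite (cut n).1.
  rewrite /mkset e -[X in _ --> X]add0e.
  apply: cvgeD => //; apply: cvgeZl => //; exact: cI.
apply: (@le_lt_trans _ _ (2 * C)%:E); last exact: ltry.
apply: (cvge_to_le (cI z)); apply: nearW => n; exact: (cut n).2.
Qed.

(** [Gamma] is the real part of an extended integral and represents it only if that is finite. For 0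
    < z < 1 the integrand is singular at 0, so finiteness is read off the recursion: an infinite
    integral times z > 0 would be infinite. *)
Lemma integral_GammaE (R : realType) (z : R) : 0 < z ->
  (\int[lebesgue_measure]_(t in `]0%R, +oo[) (t `^ (z - 1) * expR (- t))%:E =
   (Gamma z)%:E)%E.
Proof.
move=> z0; have [e] := gamma_integral_rec_lty z0.
rewrite e /Gamma /Rintegral => fin; rewrite fineK//.
rewrite ge0_fin_numE.
  move: fin; set J := integral _ _ _; clearbody J.
  by case: J => [r _| |]; rewrite ?ltry ?ltNyr// gt0_muley.
by apply: integral_ge0 => t _; rewrite lee_fin mulr_ge0 ?powR_ge0 ?expR_ge0.
Qed.

Lemma GammaD1 (R : realType) (z : R) : 0 < z -> Gamma (z + 1) = z * Gamma z.
Proof.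
move=> z0; apply: EFin_inj; rewrite EFinM -!integral_GammaE ?addr_gt0// addrK.
by have [] := gamma_integral_rec_lty z0.
Qed.

Lemma gamma_integral_scaleE (R : realType) (z c : R) : 0 < z -> 0 < c ->
  (\int[lebesgue_measure]_(t in `]0%R, +oo[) (t `^ (z - 1) * expR (- (c * t)))%:E =
   (Gamma z / c `^ z)%:E)%E.
Proof.
move=> z0 c0; rewrite gamma_integral_scale//.
under eq_integral do rewrite mul1r.
by rewrite integral_GammaE// -EFinM powRN mulrC.
Qed.

(** A zero integral would force w = 0 outside a null set, which would then contain a half-line of
    infinite measure. Strictness in the theorem rests on this. *)
Lemma integral_itvcy_gt0 (R : realType) (w : R -> \bar R) (T : R) :
  measurable_fun (`[T, +oo[%classic : set R) w ->
  (forall t : R, T <= t -> (0 < w t)%E) ->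
  (0 < \int[lebesgue_measure]_(t in `[T, +oo[) w t)%E.
Proof.
move=> mw w0.
have abs t : `[T, +oo[%classic t -> `|w t|%E = w t.
  by rewrite /= in_itv/= andbT => /w0 /ltW /gee0_abs.
rewrite lt_neqAle integral_ge0 ?andbT; last first.
  by move=> t; rewrite /= in_itv/= andbT => /w0 /ltW.
apply/negP => /eqP/esym.
under eq_integral => t do rewrite inE => /abs <-.
move=> e; have [N [mN N0 sN]] := (ae_eq_integral_abs lebesgue_measure (measurable_itv _) mw).1 e.
have : (lebesgue_measure (`[T, +oo[%classic : set R) <= lebesgue_measure N)%E.
  apply: le_measure; rewrite ?inE//; apply: subset_trans sN => t /= Tt.
  move=> /(_ Tt) /= wt0; have := w0 t; rewrite wt0 ltxx.
  by move: Tt; rewrite in_itv/= andbT => Tt /(_ Tt).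
by rewrite [X in (_ <= X)%E -> _]N0 lebesgue_measure_itv/= ltry.
Qed.

Lemma Gamma_gt0 (R : realType) (z : R) : 0 < z -> 0 < Gamma z.
Proof.
move=> z0; rewrite -lte_fin -(integral_GammaE z0).
pose u (t : R) := (t `^ (z - 1) * expR (- t))%:E.
have u0 t : 0 < t -> (0 < u t)%E by move=> t0; rewrite lte_fin mulr_gt0 ?powR_gt0 ?expR_gt0.
have mu_ (D : set R) : measurable_fun D u.
  apply: measurableT_comp => //.
  apply: (@measurable_funS _ _ _ _ setT) => //.
  apply: measurable_funM; first exact: measurable_powR.
  by apply: measurableT_comp => //; exact: measurableT_comp.
apply: (@lt_le_trans _ _ (\int[lebesgue_measure]_(t in `[1%R, +oo[) u t)%E).
  by apply: integral_itvcy_gt0 => // t /(lt_le_trans ltr01); exact: u0.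
apply: ge0_subset_integral => //=.
- exact: mu_.
- by move=> t; rewrite in_itv/= andbT => /u0 /ltW.
by move=> t; rewrite /= !in_itv/= !andbT; exact: lt_le_trans.
Qed.

(** * Convexity bounds for ratios of Gamma values *)

Lemma powRN_tangent (R : realType) (c t b : R) : 0 < c -> 0 < t -> 0 <= b ->
  c `^ (- b) * (1 + b) <= t `^ (- b) + c `^ (- b) * b / c * t.
Proof.
move=> c0 t0 b0; have tc : 0 < t / c by rewrite divr_gt0.
have -> : t `^ (- b) = (t / c) `^ (- b) * c `^ (- b).
  by rewrite -powRM ?divfK ?gt_eqF// ltW.
have := powRN_ge_tangent tc b0.
move=> /(ler_wpM2r (powR_ge0 c (- b))).
have -> : c `^ (- b) * b / c * t = c `^ (- b) * b * (t / c) by ring.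
lra.
Qed.

Lemma powR_tangent (R : realType) (c t b : R) : 0 < c -> 0 < t -> 1 <= b ->
  c `^ b * b / c * t <= t `^ b + c `^ b * (b - 1).
Proof.
move=> c0 t0 b0; have tc : 0 < t / c by rewrite divr_gt0.
have -> : t `^ b = (t / c) `^ b * c `^ b.
  by rewrite -powRM ?divfK ?gt_eqF// ltW.
have := powR_ge_tangent tc b0.
move=> /(ler_wpM2r (powR_ge0 c b)).
have -> : c `^ b * b / c * t = c `^ b * b * (t / c) by ring.
lra.
Qed.

(** Integrating against e^(-t) turns each power of t into a Gamma value. All coefficients are
    nonnegative so that extended integrals add; this is why the tangent lines above are written
    without subtraction. *)
Lemma le_Gamma_comb (R : realType) (z0 z1 z2 c0 c1 c2 : R) :
  0 < z0 -> 0 < z1 -> 0 < z2 -> 0 <= c0 -> 0 <= c1 -> 0 <= c2 ->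
  (forall t : R, 0 < t ->
    c1 * t `^ (z1 - 1) <= c0 * t `^ (z0 - 1) + c2 * t `^ (z2 - 1)) ->
  c1 * Gamma z1 <= c0 * Gamma z0 + c2 * Gamma z2.
Proof.
move=> z00 z10 z20 c00 c10 c20 le_;
pose u (w : R) (t : R) := t `^ (w - 1) * expR (- t).
have u0 w t : (0 <= (u w t)%:E)%E by rewrite lee_fin mulr_ge0 ?powR_ge0 ?expR_ge0.
have emu w (D : set R) : measurable_fun D (fun t : R => (u w t)%:E).
  apply: measurableT_comp => //.
  apply: (@measurable_funS _ _ _ _ setT) => //.
  apply: measurable_funM; first exact: measurable_powR.
  by apply: measurableT_comp => //; exact: measurableT_comp.
have EG c w : 0 <= c -> 0 < w ->
    (c%:E * (Gamma w)%:E = \int[lebesgue_measure]_(t in `]0%R, +oo[) (c%:E * (u w t)%:E))%E.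
    move=> cc ww; rewrite -(integral_GammaE ww).
  by rewrite (@ge0_integralZl_EFin _ _ R lebesgue_measure _ (measurable_itv `]0%R, +oo[)
    (fun t : R => (u w t)%:E) (fun t _ => u0 w t) (emu w _) c cc).
suff : (c1%:E * (Gamma z1)%:E <= c0%:E * (Gamma z0)%:E + c2%:E * (Gamma z2)%:E)%E.
  by [].
rewrite (EG _ _ c00 z00) (EG _ _ c10 z10) (EG _ _ c20 z20).
have cu0 c w t : 0 <= c -> (0 <= c%:E * (u w t)%:E)%E by move=> ?; exact: mule_ge0.
rewrite -ge0_integralD//; first last.
- by apply: measurable_funeM; exact: emu.
- by move=> t _; exact: cu0.
- by apply: measurable_funeM; exact: emu.
- by move=> t _; exact: cu0.
apply: ge0_le_integral => //.
- by move=> t _; exact: cu0.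
- by apply: measurable_funeM; exact: emu.
- by apply: emeasurable_funD; apply: measurable_funeM; exact: emu.
move=> t /=; rewrite in_itv/= andbT => t0.
by rewrite -!EFinM -EFinD lee_fin !mulrA -mulrDl ler_wpM2r ?expR_ge0// le_.
Qed.

(** Jensen's inequality for the convex function t^(-b) under the Gamma(z) density, whose mean is z:
    with the tangent taken at t = z, the relation Gamma(z + 1) = z Gamma(z) cancels the linear
    part. *)
Lemma Gamma_subr_ge (R : realType) (z b : R) : 0 <= b -> b < z ->
  z `^ (- b) * Gamma z <= Gamma (z - b).
Proof.
move=> b0 bz; have z0 := le_lt_trans b0 bz.
have := @le_Gamma_comb R (z - b) z (z + 1) 1 (z `^ (- b) * (1 + b)) (z `^ (- b) * b / z).
rewrite subr_gt0 bz z0 addr_gt0// !(ler01, mulr_ge0, powR_ge0, addr_ge0, invr_ge0) ?(ltW z0)//.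
have h (t : R) : 0 < t -> z `^ (- b) * (1 + b) * t `^ (z - 1) <=
    1 * t `^ (z - b - 1) + z `^ (- b) * b / z * t `^ (z + 1 - 1).
  move=> t0; have := powRN_tangent z0 t0 b0.
  move=> /(ler_wpM2r (powR_ge0 t (z - 1))) /le_trans; apply.
  have -> : z - b - 1 = - b + (z - 1) by ring.
  rewrite addrK -(powRB1M z t0) (@powRD _ t (- b)) ?(gt_eqF t0) ?implybT//.
  by rewrite mulrDl mul1r; lra.
move=> /(_ isT isT isT isT isT isT h).
rewrite GammaD1//; set G := Gamma z.
have -> : z `^ (- b) * b / z * (z * G) = z `^ (- b) * b * G by field; rewrite gt_eqF.
lra.
Qed.

(** The same argument for t^b, which is convex because b >= 1, with the tangent taken at the mean
    w. *)
Lemma GammaD_ge (R : realType) (w b : R) : 1 <= b -> 0 < w ->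
  w `^ b * Gamma w <= Gamma (w + b).
Proof.
move=> b1 w0; have b0 : 0 < b by lra.
have := @le_Gamma_comb R (w + b) (w + 1) w 1 (w `^ b * b / w) (w `^ b * (b - 1)).
rewrite w0 !addr_gt0// !(ler01, mulr_ge0, powR_ge0, invr_ge0) ?subr_ge0 ?(ltW w0) ?(ltW b0)//.
have h (t : R) : 0 < t -> w `^ b * b / w * t `^ (w + 1 - 1) <=
    1 * t `^ (w + b - 1) + w `^ b * (b - 1) * t `^ (w - 1).
  move=> t0; have := powR_tangent w0 t0 b1.
  move=> /(ler_wpM2r (powR_ge0 t (w - 1))).
  have -> : w + b - 1 = b + (w - 1) by ring.
  rewrite addrK -(powRB1M w t0) (@powRD _ t b) ?(gt_eqF t0) ?implybT//.
  by rewrite [in leRHS]mulrDl mul1r; apply: le_trans; lra.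
move=> /(_ isT isT isT isT isT isT h).
rewrite GammaD1//; set G := Gamma w.
have -> : w `^ b * b / w * (w * G) = w `^ b * b * G by field; rewrite gt_eqF.
lra.
Qed.

Lemma continuous_powR (R : realType) (a x : R) : 0 < x ->
  {for x, continuous (fun y : R => y `^ a)}.
Proof.
move=> x0; apply: differentiable_continuous; apply/derivable1_diffP.
by apply: derivable_powR; rewrite in_itv/= andbT.
Qed.

(* The two tangent-line inequalities above, taken at the mean of the Gamma
   density, squeeze the ratio. *)
Lemma cvg_Gamma_ratio (R : realType) (b : R) : 0 <= b ->
  Gamma (n%:R - b) / Gamma n%:R * n%:R `^ b @[n --> \oo] --> (1 : R).
Proof.
move=> b0.
have ninf : (n%:R : R)^-1 @[n --> \oo] --> (0 : R).
  apply/gtr0_cvgV0; last exact: cvgr_idn.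
  by near=> n; rewrite ltr0n; near: n; exists 1%N.
have hi : (1 - b * n%:R^-1) `^ (- (b + 1)) @[n --> \oo] --> (1 : R).
  have : 1 - b * n%:R^-1 @[n --> \oo] --> 1 - b * 0.
    by apply: cvgB; [exact: cvg_cst|exact: cvgMr].
  rewrite mulr0 subr0 => h.
  suff : (1 - b * n%:R^-1) `^ (- (b + 1)) @[n --> \oo] --> (1 : R) `^ (- (b + 1)).
    by rewrite powR1.
  have cp : x `^ (- (b + 1)) @[x --> (1 : R)] --> (1 : R) `^ (- (b + 1)).
    exact: continuous_powR.
  exact: (cvg_comp _ _ h cp).
apply: (@squeeze_cvgr _ _ _ _ (fun=> 1) (fun n => (1 - b * n%:R^-1) `^ (- (b + 1))));
  last exact: hi; last exact: cvg_cst.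
near=> n.
have nb : b < n%:R by near: n; exact: nbhs_infty_gtr.
have n0 : (0 : R) < n%:R by exact: le_lt_trans nb.
have G0 := Gamma_gt0 n0.
have nb0 : 0 < n%:R - b by rewrite subr_gt0.
apply/andP; split.
  have := Gamma_subr_ge b0 nb; rewrite powRN => h.
  move: (Gamma _) (Gamma _) G0 h => g1 g2 G0 h.
  by rewrite mulrAC ler_pdivlMr// mul1r mulrC -ler_pdivrMl ?powR_gt0.
(* The exponent [b] may lie below 1, where t^b is concave. With b + 1 and w = n - b the right side
   is Gamma(n + 1) = n Gamma(n); this gives the exponent in [hi]. *)
have b1 : 1 <= b + 1 by rewrite lerDr.
have := GammaD_ge b1 nb0; rewrite addrA subrK GammaD1// => h.
have -> : 1 - b / n%:R = (n%:R - b) / n%:R by field; rewrite gt_eqF.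
have -> : ((n%:R - b) / n%:R) `^ (- (b + 1)) = n%:R `^ b * n%:R / (n%:R - b) `^ (b + 1).
  rewrite powRM ?invr_ge0 ?(ltW nb0) ?(ltW n0)// mulrC -(powR_inv1 (ltW n0)) -powRrM mulN1r opprK.
  by rewrite -(powRB1M (b + 1) n0) addrK powRN.
rewrite mulrC -mulrA ler_wpM2l ?powR_ge0// ler_pdivrMr// mulrAC ler_pdivlMr ?powR_gt0//.
by rewrite mulrC.
Unshelve. all: end_near. Qed.

(** Write r + n/t = (n/t)(1 + r t/n). What remains of (n/t)^n is (n/t)^b: its factor n^b normalizes
    the Gamma ratio, and t^(-b) stays in the limit. *)
Lemma cvg_mathieu_bound (R : realType) (C r gamma alpha t : R) :
  0 < alpha -> 0 < gamma + 1 -> 0 <= r -> 0 < t ->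
  (n%:R / t) `^ n%:R * mathieu_bound C r gamma alpha n%:R (n%:R / t)
    @[n --> \oo] --> C * t `^ (- ((gamma + 1) / alpha)) * expR (- (r * t)).
Proof.
move=> al0 g0 r0 t0; set b := (gamma + 1) / alpha.
have b0 : 0 < b by rewrite divr_gt0.
have h1 := cvg_Gamma_ratio (ltW b0).
have rt0 : 0 <= r * t by rewrite mulr_ge0// ltW.
have h2 := cvg_powRN_1Ddiv b rt0.
have : C * t `^ (- b) * (Gamma (n%:R - b) / Gamma n%:R * n%:R `^ b *
    (1 + r * t / n%:R) `^ (- (n%:R - b))) @[n --> \oo] -->
    C * t `^ (- b) * (1 * expR (- (r * t))).
  by apply: cvgM; [exact: cvg_cst|exact: cvgM].
rewrite mul1r; apply: cvg_trans; apply: near_eq_cvg; near=> n.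
have nb : b < n%:R by near: n; exact: nbhs_infty_gtr.
have n0 : (0 : R) < n%:R by exact: lt_trans nb.
have nt : 0 < n%:R / t by rewrite divr_gt0.
rewrite /mathieu_bound -/b.
have rn : 0 < 1 + r * t / n%:R by rewrite ltr_pwDl// divr_ge0// ltW.
have -> : r + n%:R / t = n%:R / t * (1 + r * t / n%:R).
  by field; rewrite !gt_eqF.
rewrite (@powRM _ (n%:R / t) (1 + _)) ?(ltW nt) ?(ltW rn)//.
have -> : (n%:R / t) `^ n%:R = (n%:R / t) `^ (n%:R - b) * (n%:R `^ b * t `^ (- b)).
  have -> : n%:R `^ b * t `^ (- b) = (n%:R / t) `^ b.
    by rewrite powRM ?invr_ge0 ?(ltW n0) ?(ltW t0)// -(powR_inv1 (ltW t0)) -powRrM mulN1r.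
  by rewrite -powRD ?subrK// gt_eqF ?implybT.
rewrite (powRN (1 + _)).
set u := _ `^ (_ - b); set v := _ `^ (_ - b).
have u0 : u != 0 by rewrite gt_eqF ?powR_gt0.
have v0 : v != 0 by rewrite gt_eqF ?powR_gt0.
have G0 : Gamma (n%:R : R) != 0 by exact: lt0r_neq0 (Gamma_gt0 n0).
move: (Gamma _) (Gamma _) G0 => g1 g2 G0.
field.
by rewrite u0 v0 G0.
Unshelve. all: end_near. Qed.

(** * The order of f at the origin *)

Lemma sum_le_telescope (R : numDomainType) (u g : nat -> R) (N : nat) :
  (forall k, u k <= g k.+1 - g k) -> \sum_(0 <= k < N) u k <= g N - g 0%N.
Proof.
move=> ug; rewrite -(telescope_sumr g (leq0n N)).
by apply: ler_sum => k _; exact: ug.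
Qed.

Lemma nneseries_le_EFin (R : realType) (u : nat -> R) (M : R) :
  (forall k, 0 <= u k) -> (forall N, \sum_(0 <= k < N) u k <= M) ->
  (\sum_(0 <= k <oo) (u k)%:E <= M%:E)%E.
Proof.
move=> u0 uM; apply: lime_le.
  by apply: is_cvg_nneseries => n _ _; rewrite lee_fin.
by apply: nearW => N; rewrite sumEFin lee_fin.
Qed.

Lemma le_partial_nneseries (R : realType) (u : nat -> R) (N : nat) :
  (forall k, 0 <= u k) ->
  ((\sum_(0 <= k < N) u k)%:E <= \sum_(0 <= k <oo) (u k)%:E)%E.
Proof.
move=> u0; rewrite -sumEFin; apply: nneseries_lim_ge => k _ _.
by rewrite lee_fin.
Qed.

(** One lower bound for both signs of g: for s in [r, 1/r], the worse of s^g and its reciprocal is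
    still at least r^|g|. It replaces monotonicity of x^gamma. *)
Lemma powR_ratio_ge (R : realType) (r s g : R) : 0 < r -> r <= 1 ->
  r <= s -> s <= r^-1 -> r `^ `|g| <= s `^ g.
Proof.
move=> r0 r1 rs sr; have s0 := lt_le_trans r0 rs.
have [g0|g0] := leP 0 g.
  by rewrite ger0_norm// ge0_ler_powR// nnegrE ltW.
have -> : s `^ g = s^-1 `^ (- g).
  by rewrite -(powR_inv1 (ltW s0)) -powRrM mulN1r opprK.
rewrite ltr0_norm// ge0_ler_powR ?nnegrE ?invr_ge0 ?(ltW r0) ?(ltW s0)//; first lra.
by rewrite -[r]invrK lef_pV2 ?posrE ?invr_gt0.
Qed.

Lemma le_powRN (R : realType) (x y e : R) : 0 < x -> x <= y -> 0 <= e ->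
  y `^ (- e) <= x `^ (- e).
Proof.
move=> x0 xy e0; have y0 := lt_le_trans x0 xy.
by rewrite 2!powRN lef_pV2 ?posrE ?powR_gt0// ge0_ler_powR// nnegrE ltW.
Qed.

(* With y = x^alpha t the primitive is (y / (1 + y))^b, which stays in [0, 1]:
   telescoping it bounds the sum of its derivative. *)
Lemma mathieu_kernel_derive (R : realType) (gamma alpha t x : R) :
  0 < alpha -> 0 < t -> 0 < x ->
  let b := (gamma + 1) / alpha in
  is_derive x 1 (fun u : R => (1 + t^-1 * u `^ (- alpha)) `^ (- b))
   (alpha * b * t `^ b * (x `^ gamma * (1 + x `^ alpha * t) `^ (- (b + 1)))).
Proof.
move=> al0 t0 x0 b.
pose h (u : R) := 1 + t^-1 * u `^ (- alpha).
have h0 : 0 < h x by rewrite ltr_pwDl// mulr_ge0 ?invr_ge0 ?powR_ge0// ltW.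
have dh : is_derive x 1 h (t^-1 * (- alpha * x `^ (- alpha - 1))).
  have ? := is_derive1_powR (- alpha) x0.
  by apply: is_derive_eq; rewrite /GRing.scale/=; ring.
have dp := is_derive1_powR (- b) h0.
suff e : - b * h x `^ (- b - 1) * (t^-1 * (- alpha * x `^ (- alpha - 1))) =
    alpha * b * t `^ b * (x `^ gamma * (1 + x `^ alpha * t) `^ (- (b + 1))).
  by rewrite -e; exact: (is_derive1_comp dp dh).
have -> : 1 + x `^ alpha * t = h x * (x `^ alpha * t).
  rewrite /h powRN; field.
  by rewrite !gt_eqF ?powR_gt0.
rewrite (@powRM _ (h x)) ?(ltW h0) ?mulr_ge0 ?powR_ge0 ?(ltW t0)//.
rewrite powRM ?powR_ge0 ?(ltW t0)// -powRrM.
have -> : - b - 1 = - (b + 1) by ring.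
(* Since alpha b = gamma + 1, the exponents satisfy gamma - alpha (b + 1) = - alpha - 1. *)
have -> : x `^ (- alpha - 1) = x `^ gamma * x `^ (alpha * - (b + 1)).
  rewrite -powRD ?(gt_eqF x0) ?implybT//; congr (_ `^ _).
  by rewrite /b; field; rewrite gt_eqF.
have -> : t^-1 = t `^ b * t `^ (- (b + 1)).
  by rewrite -powRD ?(gt_eqF t0) ?implybT// -(powR_inv1 (ltW t0)); congr (_ `^ _); ring.
ring.
Qed.

(** By the mean value theorem the increment is the derivative at some x in ]c, c + 1[. Its second
    factor decreases, so it is at least the value at c + 1; for the power x^gamma, the ratio x/(c +
    1) lies between a/(1 + a) and 1. *)
Lemma mathieu_kernel_step (R : realType) (a gamma alpha t c : R) :
  0 < a -> 0 < gamma + 1 -> 0 < alpha -> 0 < t -> a <= c ->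
  let b : R := (gamma + 1) / alpha in
  let G (u : R) : R := (1 + t^-1 * u `^ (- alpha)) `^ (- b) in
  is_true (alpha * b * t `^ b * ((a / (1 + a)) `^ `|gamma| *
    ((c + 1) `^ gamma * (1 + (c + 1) `^ alpha * t) `^ (- (b + 1))))
    <= G (c + 1) - G c).
Proof.
move=> a0 g0 al0 t0 ac b G.
have b0 : 0 < b by rewrite divr_gt0.
have c0 : 0 < c by exact: lt_le_trans ac.
have cc : c < c + 1 by rewrite ltrDl.
have c10 := lt_trans c0 cc.
pose v (u : R) := u `^ gamma * (1 + u `^ alpha * t) `^ (- (b + 1)).
have dG (x : R) : 0 < x -> is_derive x 1 G (alpha * b * t `^ b * v x).
  exact: mathieu_kernel_derive.
have dI (x : R) : x \in `]c, c + 1[ -> is_derive x 1 G (alpha * b * t `^ b * v x).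
  by rewrite in_itv/= => /andP[/(lt_trans c0) x0 _]; exact: dG.
have cG : {within `[c, c + 1], continuous G}.
  apply: derivable_within_continuous => x; rewrite in_itv/= => /andP[/(lt_le_trans c0) x0 _].
  by have ? := dG x x0; exact: ex_derive.
have [x] := MVT cc dI cG.
rewrite in_itv/= => /andP[cx xc] ->.
have x0 := lt_trans c0 cx.
have -> : c + 1 - c = 1 by ring.
have abt : 0 < alpha * b * t `^ b by apply: mulr_gt0; [exact: mulr_gt0|exact: powR_gt0].
rewrite mulr1 (ler_pM2l abt) /v mulrA.
have h1 : (a / (1 + a)) `^ `|gamma| * (c + 1) `^ gamma <= x `^ gamma.
  have -> : x = (x / (c + 1)) * (c + 1) by rewrite divfK// gt_eqF.
  rewrite (@powRM _ (x / _)) ?divr_ge0 ?(ltW x0) ?(ltW c10)// ler_wpM2r ?powR_ge0//.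
  apply: powR_ratio_ge.
  - by rewrite divr_gt0// addr_gt0.
  - by rewrite ler_pdivrMr ?addr_gt0// mul1r lerDr.
  - by rewrite ler_pdivlMr// mulrAC ler_pdivrMr ?addr_gt0//; nra.
  - apply: (@le_trans _ _ 1); first by rewrite ler_pdivrMr// mul1r ltW.
    by rewrite invf_div ler_pdivlMr// mul1r lerDr.
have h2 : (1 + (c + 1) `^ alpha * t) `^ (- (b + 1)) <= (1 + x `^ alpha * t) `^ (- (b + 1)).
  apply: le_powRN.
  - by rewrite ltr_pwDl// mulr_ge0 ?powR_ge0// ltW.
  - rewrite lerD2l ler_wpM2r ?(ltW t0)//.
    by apply: ge0_ler_powR; rewrite ?nnegrE ltW.
  - by rewrite addr_ge0// ltW.
by apply: ler_pM h1 h2; rewrite ?mulr_ge0 ?powR_ge0.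
Qed.

Lemma mathieu_kernel_le (R : realType) (a gamma alpha : R) :
  0 < a -> 0 < gamma + 1 -> 0 < alpha ->
  let b := (gamma + 1) / alpha in
  exists2 C, 0 < C & forall t : R, 0 < t -> forall N : nat,
  \sum_(0 <= k < N)
     ((k%:R + a) `^ gamma * (1 + (k%:R + a) `^ alpha * t) `^ (- (b + 1)))
   <= C * t `^ (- b).
Proof.
move=> a0 g0 al0 b.
have b0 : 0 < b by rewrite divr_gt0.
pose r := a / (1 + a).
have r0 : 0 < r by rewrite divr_gt0// addr_gt0.
pose q := alpha * b * r `^ `|gamma|.
have q0 : 0 < q by apply: mulr_gt0; [exact: mulr_gt0|exact: powR_gt0].
(* [q^-1] covers the terms k >= 1, whose increments of [G] sum to at most 1; the step bounds values
   at right endpoints, so k = 0 is separate and costs [a^-1]. *)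
exists (q^-1 + a^-1); first by rewrite addr_gt0 ?invr_gt0.
move=> t t0 N.
pose G (u : R) := (1 + t^-1 * u `^ (- alpha)) `^ (- b).
pose v (u : R) := u `^ gamma * (1 + u `^ alpha * t) `^ (- (b + 1)).
have v0 u : 0 <= v u by rewrite mulr_ge0 ?powR_ge0.
have step (k : nat) : q * t `^ b * v (k.+1%:R + a) <= G (k.+1%:R + a) - G (k%:R + a).
  have ak : a <= k%:R + a by rewrite lerDr.
  have := mathieu_kernel_step a0 g0 al0 t0 ak.
  have -> : k.+1%:R + a = k%:R + a + 1 by rewrite -natr1; ring.
  have -> : q * t `^ b * v (k%:R + a + 1) =
    alpha * b * t `^ b * (r `^ `|gamma| * v (k%:R + a + 1)) by rewrite /q; ring.
  by [].
have G1 u : G u <= 1.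
  have -> : 1 = 1 `^ (- b) :> R by rewrite powR1.
  apply: le_powRN => //; last exact: ltW.
  by rewrite lerDl mulr_ge0 ?powR_ge0// invr_ge0 ltW.
have G0 u : 0 <= G u by rewrite powR_ge0.
have tele n : \sum_(0 <= k < n) (q * t `^ b * v (k.+1%:R + a)) <= G (n%:R + a) - G (0%:R + a).
  exact: (@sum_le_telescope R (fun k => q * t `^ b * v (k.+1%:R + a)) (fun k => G (k%:R + a))).
(* With y = a^alpha t, (1 + y)^(-(b+1)) <= y^(-b), and gamma - alpha b = -1. *)
have first_term : v a <= a^-1 * t `^ (- b).
  have y0 : 0 < a `^ alpha * t by rewrite mulr_gt0 ?powR_gt0.
  apply: (@le_trans _ _ (a `^ gamma * (a `^ alpha * t) `^ (- b))).
    rewrite ler_wpM2l ?powR_ge0//.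
    apply: (@le_trans _ _ ((1 + a `^ alpha * t) `^ (- b))).
      by apply: ler_powR; [rewrite lerDl ltW|rewrite lerN2 lerDl].
    by apply: le_powRN => //; [rewrite lerDr|rewrite ltW].
  rewrite powRM ?powR_ge0 ?(ltW t0)// mulrA ler_wpM2r ?powR_ge0// -powRrM.
  rewrite -powRD ?(gt_eqF a0) ?implybT// -(powR_inv1 (ltW a0)).
  rewrite (_ : gamma + alpha * - b = -1)//; rewrite /b; field; rewrite gt_eqF//.
apply: (@le_trans _ _ (\sum_(0 <= k < N.+1) v (k%:R + a))).
  by rewrite big_nat_recr//= lerDl.
rewrite big_nat_recl//= add0r mulrDl addrC lerD// ler_pdivlMl//.
rewrite powRN -[leRHS]mul1r ler_pdivlMr ?powR_gt0// mulrAC mulr_sumr.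
by apply: (le_trans (tele N)); rewrite lerBlDr (le_trans (G1 _))// lerDl.
Qed.

Lemma f_term_ge0 (R : realType) (x a gamma alpha : R) (k : nat) :
  0 <= (k%:R + a) `^ gamma * expR (- ((k%:R + a) `^ alpha * x)).
Proof. by rewrite mulr_ge0 ?powR_ge0 ?expR_ge0. Qed.

(** Each exponential is at most the kernel of exponent b + 1 taken at t/(b + 1), and
    [mathieu_kernel_le] bounds the sum of these. *)
Lemma f_series_le (R : realType) (a gamma alpha : R) :
  0 < a -> 0 < gamma + 1 -> 0 < alpha ->
  exists2 C : R, 0 < C & forall t : R, 0 < t ->
  (f_series t a gamma alpha <= (C * t `^ (- ((gamma + 1) / alpha)))%:E)%E.
Proof.
move=> a0 g0 al0; set b := (gamma + 1) / alpha.
have b0 : 0 < b by rewrite divr_gt0.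
have [C C0 hC] := mathieu_kernel_le a0 g0 al0; rewrite -/b in hC.
have m0 : 0 < b + 1 by rewrite addr_gt0.
exists (C * (b + 1) `^ b); first by rewrite mulr_gt0 ?powR_gt0.
move=> t t0; apply: nneseries_le_EFin => [k|N]; first exact: f_term_ge0.
have tm : 0 < t / (b + 1) by rewrite divr_gt0.
have -> : C * (b + 1) `^ b * t `^ (- b) = C * (t / (b + 1)) `^ (- b).
  rewrite powRM ?(ltW t0) ?invr_ge0 ?(ltW m0)// -(powR_inv1 (ltW m0)) -powRrM mulN1r opprK.
  by rewrite -mulrA [_ `^ b * _]mulrC.
apply: le_trans (hC _ tm N); apply: ler_sum => k _.
rewrite ler_wpM2l ?powR_ge0// mulrA.
by apply: expRN_le_powRN => //; rewrite mulr_ge0 ?powR_ge0// ltW.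
Qed.

Lemma f_series_ge (R : realType) (a gamma alpha : R) :
  0 < a -> 0 < gamma + 1 -> 0 < alpha ->
  exists2 c : R, 0 < c & forall t : R, 0 < t -> t <= 1 ->
  ((c * t `^ (- ((gamma + 1) / alpha)))%:E <= f_series t a gamma alpha)%E.
Proof.
move=> a0 g0 al0.
(* On the block K <= k < 2K used below, n <= k + a <= (4 + a) n: K <= 2n gives k <= 4n, and a <= a n
   because n >= 1. *)
pose r := (4 + a)^-1.
have a4 : 0 < 4 + a by rewrite addr_gt0.
have r0 : 0 < r by rewrite invr_gt0.
have r1 : r <= 1 by rewrite /r invf_le1//; lra.
exists (r `^ `|gamma| * expR (- (4 + a) `^ alpha)).
  by rewrite mulr_gt0 ?powR_gt0 ?expR_gt0.
move=> t t0 t1.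
(* At the scale n = t^(-1/alpha) there are K >= n terms of size n^gamma. *)
pose n := t `^ (- alpha^-1).
have n1 : 1 <= n.
  have -> : 1 = 1 `^ (- alpha^-1) :> R by rewrite powR1.
  by apply: le_powRN; rewrite ?invr_ge0// ltW.
have n0 : 0 < n by exact: lt_le_trans n1.
pose K := (Num.truncn n).+1.
have nK : n <= K%:R by rewrite ltW// truncnS_gt.
have Kn : K%:R <= 2 * n.
  rewrite /K -natr1; have : (Num.truncn n)%:R <= n by rewrite truncn_le// ltW.
  lra.
pose u (k : nat) := (k%:R + a) `^ gamma * expR (- ((k%:R + a) `^ alpha * t)).
apply: le_trans (@le_partial_nneseries R u (K + K) _) => [|k]; last exact: f_term_ge0.
rewrite lee_fin (@big_cat_nat _ _ _ K)//= ?leq_addr//.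
apply: (@le_trans _ _ (\sum_(K <= k < K + K) u k)); last first.
  by rewrite lerDr sumr_ge0// => k _; exact: f_term_ge0.
apply: (@le_trans _ _ (\sum_(K <= k < K + K) (r `^ `|gamma| * expR (- (4 +
  a) `^ alpha) * n `^ gamma))).
  rewrite sumr_const_nat addnK -[leRHS]mulr_natr -[leRHS]mulrA ler_wpM2l//.
    by rewrite mulr_ge0 ?powR_ge0 ?expR_ge0.
  have -> : t `^ (- ((gamma + 1) / alpha)) = n `^ gamma * n.
    have := powRB1M (gamma + 1) n0; rewrite addrK => ->.
    by rewrite -powRrM; congr (_ `^ _); ring.
  by rewrite ler_wpM2l ?powR_ge0.
rewrite big_nat_cond [leRHS]big_nat_cond; apply: ler_sum => k.
rewrite andbT => /andP[Kk kK].
have nk : n <= k%:R + a.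
  by rewrite (le_trans nK)// ler_wpDr ?(ltW a0)// ler_nat.
have kn : k%:R + a <= (4 + a) * n.
  have : (k%:R : R) <= K%:R + K%:R by rewrite -natrD ler_nat ltnW.
  nra.
have k0 : 0 < k%:R + a by exact: lt_le_trans nk.
rewrite /u mulrAC; apply: ler_pM; rewrite ?mulr_ge0 ?powR_ge0 ?expR_ge0//.
  have -> : k%:R + a = (k%:R + a) / n * n by rewrite divfK// gt_eqF.
  rewrite (@powRM _ (_ / n)) ?divr_ge0 ?(ltW n0) ?(ltW k0)// ler_wpM2r ?powR_ge0//.
  apply: powR_ratio_ge => //.
  - by rewrite ler_pdivlMr// (le_trans _ nk)// ler_piMl// ltW.
  - by rewrite /r invrK ler_pdivrMr.
rewrite ler_expR lerN2.
apply: (@le_trans _ _ (((4 + a) * n) `^ alpha * t)).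
  by rewrite ler_wpM2r ?(ltW t0)// ge0_ler_powR ?nnegrE ?(ltW al0) ?(ltW k0) ?mulr_ge0 ?(ltW a4)
    ?(ltW n0).
rewrite powRM ?(ltW a4) ?(ltW n0)// /n -powRrM mulNr mulVf ?gt_eqF//.
by rewrite powR_inv1 ?(ltW t0)// mulfVK ?gt_eqF.
Qed.

Lemma f_series_ge_first (R : realType) (t a gamma alpha : R) :
  ((a `^ gamma * expR (- (a `^ alpha * t)))%:E <= f_series t a gamma alpha)%E.
Proof.
have := @le_partial_nneseries R _ 1 (f_term_ge0 t a gamma alpha).
by rewrite big_nat1 add0r.
Qed.

(** * Finiteness of [A_] and positivity of [B_] in terms of the shifts *)

Lemma A_leP (R : realType) (p a gamma alpha A : R) :
  (A_ p a gamma alpha <= A%:E)%E <->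
  forall t : R, 0 < t ->
  (f_series t a gamma alpha <= (A * t `^ (- ((gamma + 1) / alpha)) * expR (- (p * t)))%:E)%E.
Proof.
set b := (gamma + 1) / alpha.
have eqv (t : R) : 0 < t -> ((expR (p * t) * t `^ b)%:E * f_series t a gamma alpha <= A%:E)%E <->
  (f_series t a gamma alpha <= (A * t `^ (- b) * expR (- (p * t)))%:E)%E.
  move=> t0; have e0 : 0 < expR (p * t) * t `^ b by rewrite mulr_gt0 ?expR_gt0 ?powR_gt0.
  have -> : A * t `^ (- b) * expR (- (p * t)) = (expR (p * t) * t `^ b)^-1 * A.
    by rewrite powRN expRN invfM; ring.
  by rewrite -lee_pdivlMl// EFinM.
split=> [le t t0|le].
  apply/eqv => //; apply: le_trans le; apply: ereal_sup_ubound.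
  by exists t => //=; rewrite in_itv/= andbT.
apply/ereal_supP => y [t] /=; rewrite in_itv/= andbT => t0 <-.
by apply/eqv => //; exact: le.
Qed.

Lemma B_geP (R : realType) (q a gamma alpha B : R) :
  (B%:E <= B_ q a gamma alpha)%E <->
  forall t : R, 0 < t ->
  ((B * t `^ (- ((gamma + 1) / alpha)) * expR (- (q * t)))%:E <= f_series t a gamma alpha)%E.
Proof.
set b := (gamma + 1) / alpha.
have eqv (t : R) : 0 < t -> (B%:E <= (expR (q * t) * t `^ b)%:E * f_series t a gamma alpha)%E <->
  ((B * t `^ (- b) * expR (- (q * t)))%:E <= f_series t a gamma alpha)%E.
  move=> t0; have e0 : 0 < expR (q * t) * t `^ b by rewrite mulr_gt0 ?expR_gt0 ?powR_gt0.
  have -> : B * t `^ (- b) * expR (- (q * t)) = (expR (q * t) * t `^ b)^-1 * B.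
    by rewrite powRN expRN invfM; ring.
  by rewrite -lee_pdivrMl// EFinM.
split=> [le t t0|le].
  apply/eqv => //; apply: le_trans le _; apply: ereal_inf_lbound.
  by exists t => //=; rewrite in_itv/= andbT.
apply/ereal_infP => y [t] /=; rewrite in_itv/= andbT => t0 <-.
by apply/eqv => //; exact: le.
Qed.

(** As (k + a)^alpha >= a^alpha, subtracting p leaves at least the fraction d = 1 - p/a^alpha of it.
    Thus e^(p t) f(t) <= f(d t), and the order t^(-b) of f applies at d t. *)
Lemma A_le_EFin (R : realType) (p a gamma alpha : R) :
  0 < a -> 0 < gamma + 1 -> 0 < alpha -> 0 <= p -> p < a `^ alpha ->
  exists2 A : R, 0 < A & (A_ p a gamma alpha <= A%:E)%E.
Proof.
move=> a0 g0 al0 p0 pa; have [C C0 hC] := f_series_le a0 g0 al0.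
set b := (gamma + 1) / alpha in hC.
have aa0 : 0 < a `^ alpha by rewrite powR_gt0.
pose d := 1 - p / a `^ alpha.
have d0 : 0 < d by rewrite subr_gt0 ltr_pdivrMr// mul1r.
exists (C * d `^ (- b)); first by rewrite mulr_gt0 ?powR_gt0.
apply/A_leP => t t0; rewrite -/b.
have dt0 : 0 < d * t by rewrite mulr_gt0.
have -> : C * d `^ (- b) * t `^ (- b) * expR (- (p * t)) =
  expR (- (p * t)) * (C * (d * t) `^ (- b)).
  by rewrite powRM ?(ltW d0) ?(ltW t0)//; ring.
apply: (@le_trans _ _ ((expR (- (p * t)))%:E * f_series (d * t) a gamma alpha)%E); last first.
  by rewrite EFinM lee_wpmul2l ?lee_fin ?expR_ge0// hC.
rewrite -nneseriesZl; last by move=> k _; rewrite lee_fin f_term_ge0.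
apply: lee_nneseries => [k _ _|k _]; first by rewrite lee_fin f_term_ge0.
rewrite -EFinM lee_fin mulrCA ler_wpM2l ?powR_ge0// -expRD ler_expR.
have ak : a `^ alpha <= (k%:R + a) `^ alpha.
  by rewrite ge0_ler_powR ?nnegrE ?addr_ge0 ?(ltW al0) ?(ltW a0)// lerDr.
have : p <= (p / a `^ alpha) * (k%:R + a) `^ alpha.
  by rewrite mulrAC ler_pdivlMr// ler_wpM2l.
rewrite /d; move: (p / _) ((_ + _) `^ _) => r s h.
have := ler_wpM2r (ltW t0) h; nra.
Qed.

Lemma A_le_shift_lt (R : realType) (p a gamma alpha A : R) :
  0 < a -> 0 < gamma + 1 -> 0 < alpha -> (A_ p a gamma alpha <= A%:E)%E ->
  p < a `^ alpha.
Proof.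
move=> a0 g0 al0 /A_leP le; rewrite ltNge; apply/negP => ap.
set b := (gamma + 1) / alpha in le.
have b0 : 0 < b by rewrite divr_gt0.
(* If p >= a^alpha, the first term alone gives a^gamma t^b <= A for all t > 0; this [t] makes the
   left side |A| + 1. *)
pose s := (`|A| + 1) / a `^ gamma.
have ag : 0 < a `^ gamma by rewrite powR_gt0.
have s0 : 0 < s by rewrite divr_gt0// ltr_wpDl.
pose t := s `^ b^-1.
have t0 : 0 < t by rewrite powR_gt0.
have := le_trans (f_series_ge_first t a gamma alpha) (le t t0).
rewrite lee_fin => h.
have : a `^ gamma <= A * t `^ (- b).
  have e0 := expR_gt0 (- (p * t)).
  rewrite -(ler_pM2r e0); apply: le_trans h.
  by rewrite ler_wpM2l ?powR_ge0// ler_expR lerN2 ler_wpM2r ?(ltW t0).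
rewrite powRN ler_pdivlMr ?powR_gt0// /t -powRrM mulVf ?gt_eqF// powRr1 ?(ltW s0)//.
rewrite /s mulrCA divff ?gt_eqF// mulr1 => h2.
have := ler_norm A; lra.
Qed.

Lemma B_ge_EFin (R : realType) (q a gamma alpha : R) :
  0 < a -> 0 < gamma + 1 -> 0 < alpha -> 0 <= q -> a `^ alpha <= q ->
  exists2 B : R, 0 < B & (B%:E <= B_ q a gamma alpha)%E.
Proof.
move=> a0 g0 al0 q0 aq; have [c c0 hc] := f_series_ge a0 g0 al0.
set b := (gamma + 1) / alpha in hc.
have b0 : 0 < b by rewrite divr_gt0.
have ag : 0 < a `^ gamma by rewrite powR_gt0.
(* [c] serves t <= 1; for t > 1 the first term suffices, since t^(-b) <= 1 there. *)
exists (Num.min c (a `^ gamma)); first by rewrite lt_min c0.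
apply/B_geP => t t0; rewrite -/b.
have qt1 : expR (- (q * t)) <= 1 by rewrite expR_le1 oppr_le0 mulr_ge0// ltW.
have [t1|t1] := leP t 1.
  apply: le_trans (hc t t0 t1); rewrite lee_fin.
  apply: (@le_trans _ _ (Num.min c (a `^ gamma) * t `^ (- b))).
    by rewrite ler_piMr// mulr_ge0 ?powR_ge0// le_min (ltW c0) (ltW ag).
  by rewrite ler_wpM2r ?powR_ge0// ge_min lexx.
apply: le_trans (f_series_ge_first t a gamma alpha); rewrite lee_fin.
have tb : t `^ (- b) <= 1.
  have -> : 1 = 1 `^ (- b) :> R by rewrite powR1.
  by apply: le_powRN => //; exact: ltW.
apply: ler_pM; rewrite ?mulr_ge0 ?powR_ge0 ?expR_ge0 ?le_min ?(ltW c0) ?(ltW ag)//.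
  apply: (@le_trans _ _ (Num.min c (a `^ gamma))).
    by rewrite ler_piMr// le_min ?(ltW c0) ?(ltW ag).
  by rewrite ge_min lexx orbT.
by rewrite ler_expR lerN2 ler_wpM2r// ltW.
Qed.

(** If q < a^alpha, a shift p strictly between still has a finite upper constant A. Then B
    e^((p-q)t) <= A for all t, which e^y >= 1 + y refutes at t = A/(B(p - q)). *)
Lemma B_ge_shift_ge (R : realType) (q a gamma alpha B : R) :
  0 < a -> 0 < gamma + 1 -> 0 < alpha -> 0 <= q -> 0 < B ->
  (B%:E <= B_ q a gamma alpha)%E -> a `^ alpha <= q.
Proof.
move=> a0 g0 al0 q0 B0 /B_geP leB; rewrite leNgt; apply/negP => qa.
pose p := (q + a `^ alpha) / 2.
have qp : q < p by rewrite /p; lra.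
have pa : p < a `^ alpha by rewrite /p; lra.
clearbody p; have [A A0 /A_leP leA] := A_le_EFin a0 g0 al0 (le_trans q0 (ltW qp)) pa.
pose t := A / (B * (p - q)).
have pq0 : 0 < p - q by rewrite subr_gt0.
have t0 : 0 < t by rewrite divr_gt0// mulr_gt0.
have := le_trans (leB t t0) (leA t t0); rewrite lee_fin.
rewrite -!mulrA [B * _]mulrCA [A * _]mulrCA ler_pM2l ?powR_gt0//.
have -> : - (q * t) = - (p * t) + (p - q) * t by ring.
rewrite expRD mulrCA [A * _]mulrC ler_pM2l ?expR_gt0//.
apply/negP; rewrite -ltNge; apply: (@lt_le_trans _ _ (B * (1 + (p - q) * t))).
  have -> : B * (1 + (p - q) * t) = B + A by rewrite /t; field; rewrite !gt_eqF.
  by rewrite ltrDr.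
by rewrite ler_wpM2l ?(ltW B0)// expR_ge1Dx.
Qed.

(** * Comparison of S with its bounds *)

Lemma measurable_f_series (R : realType) (a gamma alpha : R) (D : set R) :
  measurable_fun D (fun t : R => f_series t a gamma alpha).
Proof.
apply: (@measurable_funS _ _ _ _ setT) => //.
apply: ge0_emeasurable_sum => [k t _ _|k _]; first by rewrite lee_fin f_term_ge0.
apply: measurableT_comp => //; apply: measurable_funM; first exact: measurable_cst.
by apply: measurableT_comp => //; apply: measurableT_comp => //; exact: measurable_funM.
Qed.

Lemma mathieu_S_integral (R : realType) (x a gamma alpha mu : R) :
  0 < a -> 0 <= x -> 0 < mu ->
  ((Gamma mu)%:E * mathieu_S x a gamma alpha mu =
   \int[lebesgue_measure]_(t in `]0%R, +oo[)
     ((t `^ (mu - 1) * expR (- (x * t)))%:E * f_series t a gamma alpha))%E.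
Proof.
move=> a0 x0 mu0.
have c0 k : 0 < (k%:R + a) `^ alpha + x.
  by rewrite ltr_pwDl// powR_gt0// ltr_wpDl.
pose w (k : nat) := (k%:R + a) `^ gamma.
pose u (k : nat) (t : R) : R := t `^ (mu - 1) * expR (- (((k%:R + a) `^ alpha + x) * t)).
have u0 k t : (0 <= (u k t)%:E)%E by rewrite lee_fin mulr_ge0 ?powR_ge0 ?expR_ge0.
have w0 k : 0 <= w k by exact: powR_ge0.
have wu0 k t : (0 <= (w k)%:E * (u k t)%:E)%E by apply: mule_ge0; [rewrite lee_fin;
  exact: w0|exact: u0].
have mu_ k (D : set R) : measurable_fun D (fun t : R => (u k t)%:E).
  by apply: measurableT_comp => //; exact: measurable_gamma_integrand.
transitivity (\int[lebesgue_measure]_(t in `]0%R, +oo[)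
    (\sum_(0 <= k <oo) ((w k)%:E * (u k t)%:E)))%E; last first.
  apply: eq_integral => t _; rewrite -nneseriesZl; last first.
    by move=> k _; rewrite lee_fin f_term_ge0.
  apply: eq_eseriesr => k _; rewrite -!EFinM; congr EFin.
  by rewrite /u /w mulrDl opprD expRD; ring.
rewrite integral_nneseries//; first last.
- by move=> k; apply: measurable_funeM; exact: mu_.
rewrite -nneseriesZl; last first.
  by move=> k _; rewrite lee_fin divr_ge0 ?powR_ge0.
apply: eq_eseriesr => k _.
rewrite (@ge0_integralZl_EFin _ _ R lebesgue_measure _ (measurable_itv `]0%R, +oo[)
    (fun t : R => (u k t)%:E) (fun t _ => u0 k t) (mu_ k _) (w k) (w0 k)).
rewrite (gamma_integral_scaleE mu0 (c0 k)) -!EFinM.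
by congr EFin; rewrite /w; ring.
Qed.

(** Positivity is required of r + x rather than of x, so that x = 0 is covered when the shift is
    positive. *)
Lemma mathieu_bound_integral (R : realType) (C r x gamma alpha mu : R) :
  0 <= C -> 0 < r + x -> 0 < mu -> (gamma + 1) / alpha < mu ->
  ((Gamma mu)%:E * (mathieu_bound C r gamma alpha mu x)%:E =
   \int[lebesgue_measure]_(t in `]0%R, +oo[)
     ((t `^ (mu - 1) * expR (- (x * t)))%:E *
      (C * t `^ (- ((gamma + 1) / alpha)) * expR (- (r * t)))%:E))%E.
Proof.
move=> C0 rx mu0 bmu; set b := (gamma + 1) / alpha.
have G0 := Gamma_gt0 mu0.
pose u (t : R) : R := t `^ (mu - b - 1) * expR (- ((r + x) * t)).
have u0 t : (0 <= (u t)%:E)%E by rewrite lee_fin mulr_ge0 ?powR_ge0 ?expR_ge0.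
have mu_ (D : set R) : measurable_fun D (fun t : R => (u t)%:E).
  by apply: measurableT_comp => //; exact: measurable_gamma_integrand.
transitivity (\int[lebesgue_measure]_(t in `]0%R, +oo[) (C%:E * (u t)%:E))%E; last first.
  apply: eq_integral => t; rewrite inE/= in_itv/= andbT => t0.
  rewrite -!EFinM; congr EFin; rewrite /u.
  have -> : mu - b - 1 = (mu - 1) + - b by ring.
  rewrite powRD; last by rewrite (gt_eqF t0) implybT.
  by rewrite mulrDl opprD expRD; ring.
rewrite (@ge0_integralZl_EFin _ _ R lebesgue_measure _ (measurable_itv `]0%R, +oo[)
    (fun t : R => (u t)%:E) (fun t _ => u0 t) (mu_ _) C C0).
rewrite gamma_integral_scaleE ?subr_gt0// -!EFinM; congr EFin.
rewrite /mathieu_bound -/b.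
have p0 : (r + x) `^ (mu - b) != 0 by rewrite gt_eqF ?powR_gt0.
move: (Gamma _) (Gamma _) G0 => g1 g2 G0.
by field; rewrite p0 gt_eqF.
Qed.

(** Split at T: the surplus [w] has a positive integral over [T, +oo[, and finiteness of the
    integral of [u] keeps that surplus from being absorbed by +oo. *)
Lemma lt_integral_oy (R : realType) (u v w : R -> \bar R) (T : R) :
  0 < T ->
  (forall D : set R, measurable_fun D u) ->
  (forall D : set R, measurable_fun D v) ->
  (forall D : set R, measurable_fun D w) ->
  (forall t, 0 < t -> (0 <= u t)%E) ->
  (forall t, 0 < t -> (u t <= v t)%E) ->
  (forall t, T <= t -> (0 < w t)%E) ->
  (forall t, T <= t -> (u t + w t <= v t)%E) ->
  (\int[lebesgue_measure]_(t in `]0%R, +oo[) u t < +oo)%E ->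
  (\int[lebesgue_measure]_(t in `]0%R, +oo[) u t <
   \int[lebesgue_measure]_(t in `]0%R, +oo[) v t)%E.
Proof.
move=> T0 mu_ mv mw u0 uv w0 uwv ufin.
have v0 t : 0 < t -> (0 <= v t)%E by move=> t0; exact: le_trans (u0 _ t0) (uv _ t0).
have split_ (g : R -> \bar R) : (forall D : set R, measurable_fun D g) ->
    (forall t, 0 < t -> (0 <= g t)%E) ->
    (\int[lebesgue_measure]_(t in `]0%R, +oo[) g t =
    \int[lebesgue_measure]_(t in `]0%R, T[) g t + \int[lebesgue_measure]_(t in `[T, +oo[) g t)%E.
  move=> mg g0.
  have -> : `]0, +oo[%classic = `]0, T[%classic `|` `[T, +oo[%classic :> set R.
    apply/seteqP; split=> t; rewrite /= !in_itv/= !andbT.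
      by move=> t0; have [|] := leP T t; [right|left; rewrite t0].
    by move=> [/andP[]//|/(lt_le_trans T0)].
  rewrite ge0_integral_setU//.
  - exact: mg.
  - by move=> t [|]; rewrite /= in_itv/= => /andP[]; [move=> /g0|move=> /(lt_le_trans T0) /g0].
  - apply/disj_setPS => t []; rewrite /= !in_itv/= andbT => /andP[_ tT] /(lt_le_trans tT).
    by rewrite ltxx.
rewrite (split_ u)// (split_ v)//.
have i1 : (\int[lebesgue_measure]_(t in `]0%R, T[) u t <=
  \int[lebesgue_measure]_(t in `]0%R, T[) v t)%E.
  apply: ge0_le_integral => //.
  - by move=> t; rewrite /= in_itv/= => /andP[/u0].
  - exact: mu_.
  - exact: mv.
  - by move=> t; rewrite /= in_itv/= => /andP[/uv].
have i2 : (\int[lebesgue_measure]_(t in `[T, +oo[) u t + \int[lebesgue_measure]_(t in `[T, +oo[) w t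
   <= \int[lebesgue_measure]_(t in `[T, +oo[) v t)%E.
  rewrite -ge0_integralD//.
  - apply: ge0_le_integral => //.
    + move=> t; rewrite /= in_itv/= andbT => Tt; rewrite adde_ge0 ?u0 ?(ltW (w0 _ _))//.
      exact: lt_le_trans Tt.
    + by apply: emeasurable_funD; [exact: mu_|exact: mw].
    + exact: mv.
    + by move=> t; rewrite /= in_itv/= andbT => /uwv.
  - by move=> t; rewrite /= in_itv/= andbT => /(lt_le_trans T0) /u0.
  - exact: mu_.
  - by move=> t; rewrite /= in_itv/= andbT => /w0 /ltW.
  - exact: mw.
have i3 := integral_itvcy_gt0 (mw _) w0.
have j1 : (0 <= \int[lebesgue_measure]_(t in `]0%R, T[) u t)%E.
  by apply: integral_ge0 => t; rewrite /= in_itv/= => /andP[/u0].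
have j2 : (0 <= \int[lebesgue_measure]_(t in `[T, +oo[) u t)%E.
  by apply: integral_ge0 => t; rewrite /= in_itv/= andbT => /(lt_le_trans T0) /u0.
move: ufin; rewrite (split_ u)// => ufin.
apply: (@lt_le_trans _ _ (\int[lebesgue_measure]_(t in `]0%R, T[) u t +
  (\int[lebesgue_measure]_(t in `[T, +oo[) u t + \int[lebesgue_measure]_(t in `[T, +oo[) w t)))%E.
  rewrite addeA lteDl// ge0_fin_numE// adde_ge0//.
by apply: leeD.
Qed.

Lemma measurable_mathieu_weight (R : realType) (C r b x mu : R) (D : set R) :
  measurable_fun D (fun t : R => ((t `^ (mu - 1) * expR (- (x * t)))%:E *
      (C * t `^ (- b) * expR (- (r * t)))%:E)%E).
Proof.
apply: emeasurable_funM; apply: measurableT_comp => //.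
  exact: measurable_gamma_integrand.
apply: (@measurable_funS _ _ _ _ setT) => //.
apply: measurable_funM; first by apply: measurable_funM => //; exact: measurable_powR.
by apply: measurableT_comp => //; apply: measurableT_comp => //; exact: measurable_funM.
Qed.

Lemma measurable_weight_f_series (R : realType) (a gamma alpha x mu : R) (D : set R) :
  measurable_fun D (fun t : R => ((t `^ (mu - 1) * expR (- (x * t)))%:E *
      f_series t a gamma alpha)%E).
Proof.
apply: emeasurable_funM; last exact: measurable_f_series.
by apply: measurableT_comp => //; exact: measurable_gamma_integrand.
Qed.

Lemma mathieu_lower_lt (R : realType) (a gamma alpha q B mu x : R) :
  0 < a -> 0 < gamma + 1 -> 0 < alpha -> a `^ alpha <= q -> 0 < B ->
  (B%:E <= B_ q a gamma alpha)%E -> (gamma + 1) / alpha < mu -> 0 <= x ->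
  ((mathieu_bound B q gamma alpha mu x)%:E < mathieu_S x a gamma alpha mu)%E.
Proof.
move=> a0 g0 al0 aq B0 /B_geP leB bmu x0.
have b0 : 0 < (gamma + 1) / alpha by rewrite divr_gt0.
have mu0 := lt_trans b0 bmu.
have ag : 0 < a `^ gamma by rewrite powR_gt0.
have q0 : 0 < q by apply: lt_le_trans aq; rewrite powR_gt0.
have qx : 0 < q + x by rewrite ltr_pwDl.
rewrite -(@lte_pmul2l _ (Gamma mu)%:E) ?lte_fin ?Gamma_gt0//.
have Ib := mathieu_bound_integral (ltW B0) qx mu0 bmu.
rewrite Ib mathieu_S_integral//.
set b := (gamma + 1) / alpha in b0 leB Ib *.
(* For t >= T one has 2 B t^(-b) <= a^gamma, so by a^alpha <= q the first term of f already exceeds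
   twice the lower bound, and [w] can be the lower bound itself. *)
pose T := (2 * B / a `^ gamma) `^ b^-1.
have T0 : 0 < T by rewrite powR_gt0// divr_gt0// mulr_gt0.
pose w (t : R) := t `^ (mu - 1) * expR (- (x * t)).
have w0 t : 0 < t -> 0 < w t by move=> t0; rewrite mulr_gt0 ?powR_gt0 ?expR_gt0.
pose g (t : R) := B * t `^ (- b) * expR (- (q * t)).
have g0' t : 0 < t -> 0 < g t by move=> t0; rewrite !mulr_gt0 ?powR_gt0 ?expR_gt0.
apply: (@lt_integral_oy R _ _ (fun t => (w t)%:E * (g t)%:E)%E T) => //.
- by move=> D; exact: measurable_mathieu_weight.
- by move=> D; exact: measurable_weight_f_series.
- by move=> D; exact: measurable_mathieu_weight.
- by move=> t t0; rewrite mule_ge0 ?lee_fin ?(ltW (w0 _ t0)) ?(ltW (g0' _ t0)).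
- by move=> t t0; rewrite lee_wpmul2l ?lee_fin ?(ltW (w0 _ t0))//; exact: leB.
- by move=> t /(lt_le_trans T0) t0; rewrite mule_gt0 ?lte_fin ?w0 ?g0'.
- move=> t Tt; have t0 := lt_le_trans T0 Tt.
  apply: (@le_trans _ _ ((w t)%:E * (a `^ gamma * expR (- (a `^ alpha * t)))%:E)%E).
    rewrite -!EFinM -EFinD lee_fin -mulrDr ler_wpM2l ?(ltW (w0 _ t0))//.
    have -> : B * t `^ (- b) * expR (- (q * t)) + g t = (2 * B * t `^ (- b)) * expR (- (q * t)).
      by rewrite /g; ring.
    apply: ler_pM; rewrite ?mulr_ge0 ?powR_ge0 ?expR_ge0 ?(ltW B0)//.
      rewrite powRN ler_pdivrMr ?powR_gt0// -ler_pdivrMl// mulrC.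
      have -> : 2 * B / a `^ gamma = T `^ b.
        by rewrite /T -powRrM mulVf ?powRr1 ?gt_eqF// ltW// divr_gt0// mulr_gt0.
      by rewrite ge0_ler_powR ?nnegrE ?(ltW b0) ?(ltW T0) ?(ltW t0).
    by rewrite ler_expR lerN2 ler_wpM2r// ltW.
  by rewrite lee_wpmul2l ?lee_fin ?(ltW (w0 _ t0))//; exact: f_series_ge_first.
- by rewrite -Ib -EFinM ltry.
Qed.

Lemma mathieu_upper_lt (R : realType) (a gamma alpha p A mu x : R) :
  0 < a -> 0 < gamma + 1 -> 0 < alpha -> 0 <= p -> p < a `^ alpha ->
  (A_ p a gamma alpha <= A%:E)%E -> (gamma + 1) / alpha < mu ->
  0 <= x -> 0 < p + x ->
  (mathieu_S x a gamma alpha mu < (mathieu_bound A p gamma alpha mu x)%:E)%E.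
Proof.
move=> a0 g0 al0 p0 pa leA bmu x0 px.
have b0 : 0 < (gamma + 1) / alpha by rewrite divr_gt0.
have mu0 := lt_trans b0 bmu.
have ag : 0 < a `^ gamma by rewrite powR_gt0.
(* A second admissible shift above p bounds f with an extra decay e^(-(p'-p)t) relative to the bound
   at p. *)
pose p' := (p + a `^ alpha) / 2.
have pp' : p < p' by rewrite /p'; lra.
have pa' : p' < a `^ alpha by rewrite /p'; lra.
clearbody p'.
have [A' A'0 /A_leP leA'] := A_le_EFin a0 g0 al0 (le_trans p0 (ltW pp')) pa'.
move/A_leP : leA => leA.
have A0 : 0 < A.
  have := le_trans (f_series_ge_first 1 a gamma alpha) (leA 1 ltr01).
  rewrite lee_fin powR1 !mulr1 => h.
  have : 0 < A * expR (- p).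
    by apply: lt_le_trans h; rewrite mulr_gt0 ?expR_gt0.
  by rewrite pmulr_lgt0 ?expR_gt0.
rewrite -(@lte_pmul2l _ (Gamma mu)%:E) ?lte_fin ?Gamma_gt0//.
have Ib := mathieu_bound_integral (ltW A0) px mu0 bmu.
rewrite Ib mathieu_S_integral//.
set b := (gamma + 1) / alpha in b0 leA leA' Ib *.
(* From t = T on, A' e^(-(p'-p)t) <= A/2, by e^y >= 1 + y; f is then at most half its bound, and the
   other half is the surplus. *)
pose T := 2 * A' / (A * (p' - p)).
have d0 : 0 < p' - p by rewrite subr_gt0.
have T0 : 0 < T by rewrite divr_gt0// mulr_gt0.
pose w (t : R) := t `^ (mu - 1) * expR (- (x * t)).
have w0 t : 0 < t -> 0 < w t by move=> t0; rewrite mulr_gt0 ?powR_gt0 ?expR_gt0.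
pose g (t : R) := A / 2 * t `^ (- b) * expR (- (p * t)).
have g0' t : 0 < t -> 0 < g t.
  by move=> t0; apply: mulr_gt0; rewrite ?expR_gt0// mulr_gt0 ?powR_gt0 ?divr_gt0.
have f0 t : (0 <= f_series t a gamma alpha)%E.
  by apply: nneseries_ge0 => k _ _; rewrite lee_fin f_term_ge0.
apply: (@lt_integral_oy R _ _ (fun t => (w t)%:E * (g t)%:E)%E T) => //.
- by move=> D; exact: measurable_weight_f_series.
- by move=> D; exact: measurable_mathieu_weight.
- by move=> D; exact: measurable_mathieu_weight.
- by move=> t t0; rewrite mule_ge0 ?lee_fin ?(ltW (w0 _ t0)).
- by move=> t t0; rewrite lee_wpmul2l ?lee_fin ?(ltW (w0 _ t0))//; exact: leA.
- by move=> t /(lt_le_trans T0) t0; rewrite mule_gt0 ?lte_fin ?w0 ?g0'.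
- move=> t Tt; have t0 := lt_le_trans T0 Tt.
  have h : (f_series t a gamma alpha <= (g t)%:E)%E.
    apply: le_trans (leA' _ t0) _; rewrite lee_fin /g.
    have -> : - (p' * t) = - (p * t) + - ((p' - p) * t) by ring.
    rewrite expRD mulrA mulrAC ler_wpM2r ?expR_ge0// mulrAC ler_wpM2r ?powR_ge0//.
    rewrite expRN ler_pdivrMr ?expR_gt0//.
    apply: (@le_trans _ _ (A / 2 * (1 + (p' - p) * t))); last first.
      by rewrite ler_wpM2l ?expR_ge1Dx// divr_ge0// ltW.
    have : 2 * A' <= t * (A * (p' - p)) by rewrite -ler_pdivrMr// mulr_gt0.
    lra.
  apply: (@le_trans _ _ ((w t)%:E * (g t)%:E + (w t)%:E * (g t)%:E)%E).
    by rewrite leeD2r// lee_wpmul2l// lee_fin (ltW (w0 _ t0)).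
  rewrite -!EFinM -EFinD lee_fin -mulrDr ler_wpM2l ?(ltW (w0 _ t0))//.
  by rewrite /g le_eqVlt; apply/orP; left; apply/eqP; field.
- apply: (@le_lt_trans _ _ (Gamma mu * mathieu_bound A p gamma alpha mu x)%:E); last exact: ltry.
  rewrite EFinM Ib; apply: ge0_le_integral => //.
  + by move=> t; rewrite /= in_itv/= andbT => t0; rewrite mule_ge0// lee_fin (ltW (w0 _ t0)).
  + exact: measurable_weight_f_series.
  + exact: measurable_mathieu_weight.
  + move=> t; rewrite /= in_itv/= andbT => t0.
    by rewrite lee_wpmul2l ?lee_fin ?(ltW (w0 _ t0))//; exact: leA.
Qed.

(** * From the inequalities for S back to pointwise bounds for f *)

Lemma mathieu_term_scale (R : realType) (c gamma alpha t n : R) :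
  0 < c -> 0 < t -> 0 < n ->
  (n / t) `^ n * (c `^ gamma / (c `^ alpha + n / t) `^ n) =
  c `^ gamma * (1 + c `^ alpha * t / n) `^ (- n).
Proof.
move=> c0 t0 n0; have nt : 0 < n / t by rewrite divr_gt0.
have p0 : 0 < 1 + c `^ alpha * t / n.
  by rewrite ltr_pwDl// divr_ge0 ?mulr_ge0 ?powR_ge0// ltW.
have -> : c `^ alpha + n / t = n / t * (1 + c `^ alpha * t / n).
  by field; rewrite !gt_eqF.
rewrite (@powRM _ (n / t)) ?(ltW nt) ?(ltW p0)// powRN.
have u0 : (n / t) `^ n != 0 by rewrite gt_eqF ?powR_gt0.
have v0 : (1 + c `^ alpha * t / n) `^ n != 0 by rewrite gt_eqF ?powR_gt0.
by field; rewrite u0 v0.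
Qed.

Lemma mathieu_S_scale (R : realType) (a gamma alpha t n : R) :
  0 < a -> 0 < t -> 0 < n ->
  (((n / t) `^ n)%:E * mathieu_S (n / t) a gamma alpha n =
  \sum_(0 <= k <oo) ((k%:R + a) `^ gamma * (1 + (k%:R + a) `^ alpha * t / n) `^ (- n))%:E)%E.
Proof.
move=> a0 t0 n0; rewrite -nneseriesZl; last first.
  by move=> k _; rewrite lee_fin divr_ge0 ?powR_ge0.
apply: eq_eseriesr => k _; rewrite -EFinM mathieu_term_scale//.
by rewrite ltr_wpDl.
Qed.

(** Term by term f(t) <= (n/t)^n S(n/t, n) for each n > 0, so only the closed-form bound goes to its
    limit. Asking the hypothesis for large n alone serves both mu > mu0 and the passage to m(oo,
    a). *)
Lemma f_series_le_of_mathieu_upper (R : realType) (a gamma alpha t p A : R) :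
  0 < a -> 0 < gamma + 1 -> 0 < alpha -> 0 <= p -> 0 < t ->
  (\forall n \near \oo, (mathieu_S (n%:R / t) a gamma alpha n%:R <=
     (mathieu_bound A p gamma alpha n%:R (n%:R / t))%:E)%E) ->
  (f_series t a gamma alpha <=
    (A * t `^ (- ((gamma + 1) / alpha)) * expR (- (p * t)))%:E)%E.
Proof.
move=> a0 g0 al0 p0 t0 le.
have : ((n%:R / t) `^ n%:R * mathieu_bound A p gamma alpha n%:R (n%:R / t))%:E @[n --> \oo]
    --> (A * t `^ (- ((gamma + 1) / alpha)) * expR (- (p * t)))%:E.
  by apply: cvg_EFin; [exact: nearW|exact: cvg_mathieu_bound].
move=> /cvge_to_ge; apply; near=> n.
have n0 : (0 : R) < n%:R by near: n; exact: nbhs_infty_gtr.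
have nt : 0 < n%:R / t by rewrite divr_gt0.
apply: (@le_trans _ _ (((n%:R / t) `^ n%:R)%:E * mathieu_S (n%:R / t) a gamma alpha n%:R)%E).
  rewrite mathieu_S_scale//; apply: lee_nneseries => [k _ _|k _].
    by rewrite lee_fin f_term_ge0.
  rewrite lee_fin ler_wpM2l ?powR_ge0//; apply: expRN_le_powRN => //.
  by rewrite mulr_ge0 ?powR_ge0// ltW.
rewrite /= EFinM lee_wpmul2l ?lee_fin ?powR_ge0//.
by near: n.
Unshelve. all: end_near. Qed.

(** Here the rescaled series lies above f, so its limit is needed. Cut at N: the finite part
    converges to the partial sum of f, and for n >= b + 1 the tail is below that of the summable
    majorant with exponent b + 1. Let n tend to infinity, then N. *)
Lemma f_series_ge_of_mathieu_lower (R : realType) (a gamma alpha t q B : R) :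
  0 < a -> 0 < gamma + 1 -> 0 < alpha -> 0 <= q -> 0 < t ->
  (\forall n \near \oo, ((mathieu_bound B q gamma alpha n%:R (n%:R / t))%:E <=
     mathieu_S (n%:R / t) a gamma alpha n%:R)%E) ->
  ((B * t `^ (- ((gamma + 1) / alpha)) * expR (- (q * t)))%:E <=
    f_series t a gamma alpha)%E.
Proof.
move=> a0 g0 al0 q0 t0 le.
have b0 : 0 < (gamma + 1) / alpha by rewrite divr_gt0.
have [C C0 hC] := mathieu_kernel_le a0 g0 al0.
have cL := @cvg_mathieu_bound R B q gamma alpha t al0 g0 q0 t0.
set b := (gamma + 1) / alpha in b0 hC cL *.
set L := B * _ * _ in cL *.
have m0 : 0 < b + 1 by rewrite addr_gt0.
pose u (n : R) k := (k%:R + a) `^ gamma * (1 + (k%:R + a) `^ alpha * t / n) `^ (- n).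
pose e k := (k%:R + a) `^ gamma * expR (- ((k%:R + a) `^ alpha * t)).
have u0 n k : 0 <= u n k by rewrite mulr_ge0 ?powR_ge0.
have e0 k : 0 <= e k by exact: f_term_ge0.
have finD : (\sum_(0 <= k <oo) (u (b + 1) k)%:E < +oo)%E.
  apply: (@le_lt_trans _ _ (C * (t / (b + 1)) `^ (- b))%:E); last exact: ltry.
  apply: nneseries_le_EFin => // N.
  apply: le_trans (hC (t / (b + 1)) _ N); last by rewrite divr_gt0.
  by apply: ler_sum => k _; rewrite /u mulrA.
have tail0 := nneseries_tail_cvg finD (fun k _ => u0 (b + 1) k).
have ck k : u n%:R k @[n --> \oo] --> e k.
  apply: cvgMr; have y0 : 0 <= (k%:R + a) `^ alpha * t by rewrite mulr_ge0 ?powR_ge0// ltW.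
  by have := cvg_powRN_1Ddiv 0 y0; under eq_fun do rewrite subr0.
have cu N : \sum_(0 <= k < N) u n%:R k @[n --> \oo] --> \sum_(0 <= k < N) e k.
  elim: N => [|N IH].
    rewrite big_nil; under eq_fun do rewrite big_nil; exact: cvg_cst.
  rewrite big_nat_recr//=; under eq_fun do rewrite big_nat_recr//=.
  by apply: cvgD; [exact: IH|exact: ck].
have step N : (L%:E <= f_series t a gamma alpha + \sum_(N <= k <oo) (u (b + 1) k)%:E)%E.
  have part : (((\sum_(0 <= k < N) e k)%:E <= f_series t a gamma alpha))%E.
    exact: le_partial_nneseries.
  apply: le_trans (leeD2r _ part).
  rewrite -leeBlDl// -EFinB.
  have : ((n%:R / t) `^ n%:R * mathieu_bound B q gamma alpha n%:R (n%:R / t) -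
      \sum_(0 <= k < N) u n%:R k)%:E @[n --> \oo] --> (L - \sum_(0 <= k < N) e k)%:E.
    apply: cvg_EFin; first exact: nearW.
    by apply: cvgB; [exact: cL|exact: cu].
  move=> /cvge_to_le; apply; near=> n.
  have n0 : (0 : R) < n%:R by near: n; exact: nbhs_infty_gtr.
  have mn : b + 1 <= n%:R by near: n; exact: nbhs_infty_ger.
  rewrite /= EFinB leeBlDl//.
  apply: (@le_trans _ _ (((n%:R / t) `^ n%:R)%:E * mathieu_S (n%:R / t) a gamma alpha n%:R)%E).
    rewrite EFinM lee_wpmul2l ?lee_fin ?powR_ge0//.
    by near: n.
  rewrite mathieu_S_scale// (@nneseries_split _ _ 0 N)//; last first.
    by move=> k _; rewrite lee_fin mulr_ge0 ?powR_ge0.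
  rewrite add0n sumEFin leeD2l//; apply: lee_nneseries => [k _ _|k _].
    by rewrite lee_fin mulr_ge0 ?powR_ge0.
  rewrite lee_fin ler_wpM2l ?powR_ge0//; apply: powRN_1Ddiv_le => //.
  by rewrite mulr_ge0 ?powR_ge0// ltW.
have fin : f_series t a gamma alpha \is a fin_num.
  have [C' _ hC'] := f_series_le a0 g0 al0.
  rewrite ge0_fin_numE; first exact: le_lt_trans (hC' t t0) (ltry _).
  by apply: nneseries_ge0 => k _ _; rewrite lee_fin f_term_ge0.
have : (f_series t a gamma alpha + \sum_(N <= k <oo) (u (b + 1) k)%:E)%E @[N --> \oo]
    --> (f_series t a gamma alpha + 0)%E.
  by apply: cvgeD => //; [exact: fin_num_adde_defr|exact: cvg_cst].
rewrite adde0 => /cvge_to_ge; apply; exact: nearW.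
Unshelve. all: end_near. Qed.

(** * The case gamma = 1, alpha = 2 *)

(* Telescoping 2^-1 t^-1 e^(-(u^2-u)t) over u = k + a: its decrement from u to
   u + 1 is t^-1 e^(-u^2 t) sinh(u t) >= u e^(-u^2 t). *)
Lemma f_series12_le (R : realType) (t a : R) : 1 <= a -> 0 < t ->
  (f_series t a 1 2 <= (2^-1 * t^-1 * expR (- ((a ^+ 2 - a) * t)))%:E)%E.
Proof.
move=> a1 t0; apply: nneseries_le_EFin => [k|N]; first exact: f_term_ge0.
pose g (k : nat) : R := - (2^-1 * t^-1 * expR (- (((k%:R + a) ^+ 2 - (k%:R + a)) * t))).
apply: (@le_trans _ _ (g N - g 0%N)); last first.
  rewrite /g add0r opprK gerDr oppr_le0.
  by rewrite !mulr_ge0 ?invr_ge0 ?expR_ge0// ltW.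
apply: sum_le_telescope => k; rewrite /g.
have c0 : 0 < k%:R + a by rewrite ltr_wpDl//; lra.
have -> : k.+1%:R + a = k%:R + a + 1 by rewrite -natr1; ring.
set c := k%:R + a in c0 *; clearbody c; clear g.
rewrite powRr1 ?(ltW c0)// (powR_mulrn 2 (ltW c0)).
have -> : - (((c + 1) ^+ 2 - (c + 1)) * t) = - (c ^+ 2 * t) - c * t by ring.
have -> : - ((c ^+ 2 - c) * t) = - (c ^+ 2 * t) + c * t by ring.
rewrite !(expRD (- _)).
have ct : 0 <= c * t by rewrite mulr_ge0 ?ltW.
have := ler_wpM2l (ltW (expR_gt0 (- (c ^+ 2 * t)))) (expR_sub_ge ct).
set E := expR (- (c ^+ 2 * t)); set X := expR (c * t); set Y := expR (- (c * t)) => h.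
rewrite -(@ler_pM2r _ (2 * t)) ?mulr_gt0//.
have -> : (- (2^-1 / t * (E * Y)) - - (2^-1 / t * (E * X))) * (2 * t) = E * (X - Y).
  by field; rewrite gt_eqF.
by apply: le_trans h; rewrite le_eqVlt; apply/orP; left; apply/eqP; ring.
Qed.

(* The factor 1 + (u - 1/2) t in the telescoped function h is chosen so that, with
   w = (u + 1/2) t, the decrement of h is controlled by (1 - w) e^(2w) <= 1 + w. *)
Lemma f_series12_ge (R : realType) (t a : R) : 1 <= a -> 0 < t ->
  ((2^-1 * t^-1 * expR (- (a ^+ 2 * t)))%:E <= f_series t a 1 2)%E.
Proof.
move=> a1 t0.
pose h (u : R) : R := 2^-1 * t^-1 * (expR (- (u ^+ 2 * t)) * (1 + (u - 2^-1) * t)).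
have step (c : R) : a <= c -> h c - h (c + 1) <= c * expR (- (c ^+ 2 * t)).
  move=> ac; rewrite /h.
  have -> : - ((c + 1) ^+ 2 * t) = - (c ^+ 2 * t) + - (2 * ((c + 2^-1) * t)) by field.
  rewrite expRD.
  set w := (c + 2^-1) * t.
  have w0 : 0 <= w by rewrite mulr_ge0 ?(ltW t0)//; lra.
  have := expR2_bound w0.
  rewrite -ler_pdivlMr ?expR_gt0// -expRN => hw.
  have := ler_wpM2l (ltW (expR_gt0 (- (c ^+ 2 * t)))) hw.
  set E := expR (- (c ^+ 2 * t)); set Y := expR (- (2 * w)) => hE.
  rewrite -(@ler_pM2r _ (2 * t)) ?mulr_gt0//.
  have -> : (2^-1 / t * (E * (1 + (c - 2^-1) * t)) - 2^-1 / t * (E * Y * (1 + (c +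
    1 - 2^-1) * t))) * (2 * t)
    = E * (1 + (c - 2^-1) * t) - E * (Y * (1 + w)).
    by rewrite /w; field; rewrite gt_eqF.
  move: hE; rewrite [Y * _]mulrC => hE; apply: (@le_trans _ _ (E * (1 +
    (c - 2^-1) * t) - E * (1 - w))).
    by rewrite lerD2l lerN2.
  by rewrite le_eqVlt; apply/orP; left; apply/eqP; rewrite /w; field.
have part N : h a - h (N%:R + a) <= \sum_(0 <=
  k < N) ((k%:R + a) `^ 1 * expR (- ((k%:R + a) `^ 2 * t))).
  have := @sum_le_telescope R
    (fun k => - ((k%:R + a) `^ 1 * expR (- ((k%:R + a) `^ 2 * t)))) (fun k => h (k%:R + a)) N.
  rewrite sumrN add0r lerNl opprB; apply=> k.
  have c0 : 0 < k%:R + a by rewrite ltr_wpDl//; lra.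
  rewrite powRr1 ?(ltW c0)// (powR_mulrn 2 (ltW c0)) lerNl opprB.
  have -> : k.+1%:R + a = k%:R + a + 1 by rewrite -natr1; ring.
  by apply: step; rewrite lerDr.
(* With u = N + a, 1 + y <= e^y moves the linear factor into the exponent, and u^2 - u + 1/2 >= N
   since a >= 1. So the remainder of the telescoping decays geometrically. *)
have hN N : 0 <= h (N%:R + a) <= 2^-1 * t^-1 * expR (- t) ^+ N.
  have N0 : 0 <= (N%:R : R) by [].
  have t2 : 0 <= 2^-1 * t^-1 by rewrite mulr_ge0 ?invr_ge0// ltW.
  have u0 : 0 <= 1 + (N%:R + a - 2^-1) * t.
    by rewrite addr_ge0// mulr_ge0 ?(ltW t0)//; lra.
  rewrite /h; apply/andP; split.
    by apply: mulr_ge0 => //; apply: mulr_ge0 => //; exact: expR_ge0.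
  rewrite ler_wpM2l// -expRM_natl.
  apply: (@le_trans _ _ (expR (- ((N%:R + a) ^+ 2 * t)) * expR ((N%:R + a - 2^-1) * t))).
    by rewrite ler_wpM2l ?expR_ge0// expR_ge1Dx.
  rewrite -expRD ler_expR.
  have -> : N%:R * - t = - N%:R * t by ring.
  rewrite -mulNr -mulrDl ler_wpM2r ?(ltW t0)//.
  move: (N%:R : R) N0 => n n0; nra.
have cv : (h a - h (N%:R + a))%:E @[N --> \oo] --> (h a)%:E.
  apply: cvg_EFin; first exact: nearW.
  rewrite -[X in _ --> X]subr0; apply: cvgB; first exact: cvg_cst.
  apply: (@squeeze_cvgr _ _ _ _ (fun=> 0) (fun N => 2^-1 * t^-1 * expR (- t) ^+ N)).
  - by apply: nearW => N; exact: hN.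
  - exact: cvg_cst.
  - rewrite -[X in _ --> X](mulr0 (2^-1 * t^-1)); apply: cvgMr; apply: cvg_expr.
    by rewrite ger0_norm ?expR_ge0// expR_lt1 oppr_lt0.
have ha : 2^-1 * t^-1 * expR (- (a ^+ 2 * t)) <= h a.
  rewrite /h ler_wpM2l ?mulr_ge0 ?invr_ge0 ?(ltW t0)// ler_peMr ?expR_ge0// lerDl.
  by rewrite mulr_ge0 ?(ltW t0)//; lra.
apply: (@le_trans _ _ (h a)%:E); first by rewrite lee_fin.
move: cv => /cvge_to_le; apply; apply: nearW => N.
apply: le_trans (@le_partial_nneseries R _ N (f_term_ge0 t a 1 2)).
by rewrite lee_fin part.
Qed.

(** Here b = 1, so the Gamma quotient is 1/(mu - 1). With constant 1/2 the general bound becomes the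
    one that defines [sharp_shifts]. *)
Lemma mathieu_bound12 (R : realType) (p mu x : R) : 1 < mu -> 0 < p + x ->
  mathieu_bound 2^-1 p 1 2 mu x = (2 * (mu - 1) * (p + x) `^ (mu - 1))^-1.
Proof.
move=> mu1 px; rewrite /mathieu_bound.
have -> : (1 + 1) / 2 = 1 :> R by field.
have m0 : 0 < mu - 1 by rewrite subr_gt0.
have := GammaD1 m0; rewrite subrK => ->.
have G0 := Gamma_gt0 m0.
have p0 : (p + x) `^ (mu - 1) != 0 by rewrite gt_eqF ?powR_gt0.
move: (Gamma _) G0 => g g0.
by field; rewrite p0 !gt_eqF.
Qed.

Lemma A12_leP (R : realType) (p a A : R) :
  (A_ p a 1 2 <= A%:E)%E <->
  forall t : R, 0 < t -> (f_series t a 1 2 <= (A * t^-1 * expR (- (p * t)))%:E)%E.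
Proof.
have e : (1 + 1) / 2 = 1 :> R by field.
by split=> [/A_leP h t t0|h]; [|apply/A_leP => t t0]; have := h t t0;
  rewrite e powR_inv1// ltW.
Qed.

Lemma B12_geP (R : realType) (q a B : R) :
  (B%:E <= B_ q a 1 2)%E <->
  forall t : R, 0 < t -> ((B * t^-1 * expR (- (q * t)))%:E <= f_series t a 1 2)%E.
Proof.
have e : (1 + 1) / 2 = 1 :> R by field.
by split=> [/B_geP h t t0|h]; [|apply/B_geP => t t0]; have := h t t0;
  rewrite e powR_inv1// ltW.
Qed.

Lemma A12_le_half (R : realType) (p a : R) : 1 <= a -> p <= a ^+ 2 - a ->
  (A_ p a 1 2 <= (2^-1)%:E)%E.
Proof.
move=> a1 pa; apply/A12_leP => t t0; apply: le_trans (f_series12_le a1 t0) _.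
rewrite lee_fin ler_wpM2l ?mulr_ge0 ?invr_ge0 ?(ltW t0)//.
by rewrite ler_expR lerN2 ler_wpM2r ?(ltW t0).
Qed.

Lemma A12_eq_half (R : realType) (p a : R) : 1 <= a -> 0 <= p ->
  (A_ p a 1 2 <= (2^-1)%:E)%E -> A_ p a 1 2 = (2^-1)%:E.
Proof.
move=> a1 p0 Ah.
have ge r : (A_ p a 1 2 <= r%:E)%E -> 2^-1 <= r.
  move=> /A12_leP h; rewrite leNgt; apply/negP => rh.
  have a20 : 0 < a ^+ 2 by rewrite exprn_gt0//; lra.
  (* Since 2 t f(t) >= e^(-a^2 t) is near 1 for small t, r < 1/2 fails; at this [t], e^y >= 1 + y
     yields (1/2)(1/2 + r) <= r, that is r >= 1/2. *)
  pose t := (2^-1 - r) / a ^+ 2.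
  have t0 : 0 < t by rewrite divr_gt0// subr_gt0.
  have := le_trans (f_series12_ge a1 t0) (h t t0).
  have at_ : a ^+ 2 * t = 2^-1 - r by rewrite /t mulrC divfK// gt_eqF.
  rewrite lee_fin mulrAC [r * _ * _]mulrAC ler_pM2r ?invr_gt0// at_ => le.
  have r0 : 0 < r.
    have : 0 < r * expR (- (p * t)) by apply: lt_le_trans le; rewrite mulr_gt0 ?expR_gt0.
    by rewrite pmulr_lgt0 ?expR_gt0.
  have : r * expR (- (p * t)) <= r.
    by rewrite ler_piMr ?(ltW r0)// expR_le1 oppr_le0 mulr_ge0// ltW.
  have := expR_ge1Dx (- (2^-1 - r)); lra.
move: Ah ge; case: (A_ p a 1 2) => [s| |]//.
- rewrite lee_fin => s1 /(_ s (lexx _)) ge; congr EFin.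
  by apply/eqP; rewrite eq_le s1 ge.
- by move=> _ /(_ 0 (leNye _)) h; exfalso; lra.
Qed.

Lemma B12_eq_half (R : realType) (q a : R) : 1 <= a -> a ^+ 2 <= q ->
  B_ q a 1 2 = (2^-1)%:E.
Proof.
move=> a1 aq.
have q0 : 0 < q by apply: lt_le_trans aq; rewrite exprn_gt0//; lra.
have ge : ((2^-1)%:E <= B_ q a 1 2)%E.
  apply/B12_geP => t t0; apply: le_trans (f_series12_ge a1 t0).
  rewrite lee_fin ler_wpM2l ?mulr_ge0 ?invr_ge0 ?(ltW t0)//.
  by rewrite ler_expR lerN2 ler_wpM2r ?(ltW t0).
have le r : (r%:E <= B_ q a 1 2)%E -> r <= 2^-1.
  move=> /B12_geP h; rewrite leNgt; apply/negP => rh.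
  have r0 : 0 < r by lra.
  (* Chosen so that r (1 - q t) is the midpoint of 1/2 and r, still above the upper bound 1/2 for t
     f(t). *)
  pose t := (r - 2^-1) / (2 * r * q).
  have t0 : 0 < t by rewrite divr_gt0 ?subr_gt0// !mulr_gt0.
  have := le_trans (h t t0) (f_series12_le a1 t0).
  rewrite lee_fin mulrAC [_ * _^-1 * _]mulrAC ler_pM2r ?invr_gt0// => le.
  have : 2^-1 * expR (- ((a ^+ 2 - a) * t)) <= 2^-1.
    rewrite ler_piMr// expR_le1 oppr_le0 mulr_ge0 ?(ltW t0)//; nra.
  have : r * (1 - q * t) <= r * expR (- (q * t)).
    by rewrite ler_wpM2l ?(ltW r0)// expR_ge1Dx.
  have -> : r * (1 - q * t) = r - (r - 2^-1) / 2 by rewrite /t; field; rewrite !gt_eqF.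
  lra.
move: ge le; case: (B_ q a 1 2) => [s| |]//.
- rewrite lee_fin => s1 /(_ s (lexx _)) ge; congr EFin.
  by apply/eqP; rewrite eq_le s1 ge.
- by move=> _ /(_ 1 (leey _)) h; exfalso; lra.
Qed.

(* No existence of sharp shifts is needed: when there are none, m_shift is 0, and
   0 is an admissible shift by A12_le_half. *)
Lemma mathieu_S_le_m_shift (R : realType) (mu a x : R) : 1 <= a -> 1 < mu -> 0 < x ->
  0 <= m_shift mu a /\
  (mathieu_S x a 1 2 mu <=
    ((2 * (mu - 1) * (m_shift mu a + x) `^ (mu - 1))^-1)%:E)%E.
Proof.
move=> a1 mu1 x0; rewrite /m_shift; case: xgetP => [m _ [M [m0 M0 sharp]]|_].
  split; first exact: ltW.
  have := (sharp m M (ltW m0) (ltW M0)).2; rewrite (ltW m0) !lexx => /(_ (conj isT isT)).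
  by move=> /(_ x x0)[].
split=> //; rewrite add0r; apply/ltW.
have a0 : 0 < a by lra.
have h : (A_ 0 a 1 2 <= (2^-1)%:E)%E by apply: A12_le_half => //; nra.
have := @mathieu_upper_lt R a 1 2 0 2^-1 mu x a0 _ _ (lexx 0) _ h.
rewrite mathieu_bound12 ?add0r//; apply=> //.
- by rewrite powR_gt0.
- have -> : (1 + 1) / 2 = 1 :> R by field.
  exact: mu1.
- exact: ltW.
Qed.

(** Any r below the limit is below m(n, a) for all large n, so the upper inequality with shift r
    holds at those exponents, which is all the converse samples. The limit value itself is reached
    by continuity in the shift. *)
Lemma A12_le_half_m_shift_infty (R : realType) (p a : R) : 1 <= a ->
  0 <= p -> p <= m_shift_infty a -> (A_ p a 1 2 <= (2^-1)%:E)%E.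
Proof.
move=> a1 p0; rewrite /m_shift_infty.
have small : p <= 0 -> (A_ p a 1 2 <= (2^-1)%:E)%E.
  by move=> p0'; apply: A12_le_half => //; nra.
(* A divergent lim is the default point 0. *)
case: (pselect (cvg (m_shift mu a @[mu --> +oo]))) => [cm|/dvgP ->]; last exact: small.
set l := lim _ => pl.
have [p00|p_gt0] := leP p 0; first exact: small.
have a0 : 0 < a by lra.
have half r t : 0 <= r -> r < l -> 0 < t ->
    (f_series t a 1 2 <= (2^-1 * t^-1 * expR (- (r * t)))%:E)%E.
  move=> r0 rl t0.
  have -> : t^-1 = t `^ (- ((1 + 1) / 2)).
    by rewrite (_ : (1 + 1) / 2 = 1) ?powR_inv1 ?(ltW t0)//; field.
  apply: f_series_le_of_mathieu_upper => //.
  have rm : \forall mu \near +oo, r < m_shift mu a by exact: cvgr_gt cm _ rl.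
  have rn : \forall n \near \oo, r < m_shift (n%:R : R) a by exact: cvgr_idn rm.
  near=> n.
  have n1 : (1 : R) < n%:R by near: n; exact: nbhs_infty_gtr.
  have nt : 0 < n%:R / t by rewrite divr_gt0//; lra.
  have [_ le] := mathieu_S_le_m_shift a1 n1 nt.
  apply: le_trans le _; rewrite mathieu_bound12 ?ltr_wpDl// lee_fin.
  have rn' : r < m_shift (n%:R : R) a by near: n.
  have n10 : 0 < (n%:R : R) - 1 by rewrite subr_gt0.
  have rt : 0 < r + n%:R / t by rewrite ltr_wpDl.
  have mt : 0 < m_shift (n%:R : R) a + n%:R / t by rewrite ltr_wpDl// (le_trans r0 (ltW rn')).
  have pos (y : R) : 0 < y -> 0 < 2 * (n%:R - 1) * y `^ (n%:R - 1).
    by move=> y0; apply: mulr_gt0; [exact: mulr_gt0|exact: powR_gt0].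
  rewrite lef_pV2 ?posrE; [|exact: pos|exact: pos].
  rewrite ler_wpM2l ?mulr_ge0 ?(ltW n10)// ge0_ler_powR ?nnegrE ?(ltW n10)//.
  - exact: ltW.
  - exact: ltW.
  - by rewrite lerD2r ltW.
apply/A12_leP => t t0.
(* The shifts p - p/(n + 1) lie strictly below p <= l because p > 0, and they tend to p. *)
have : (2^-1 * t^-1 * expR (- ((p - p * n.+1%:R^-1) * t)))%:E @[n --> \oo]
    --> (2^-1 * t^-1 * expR (- (p * t)))%:E.
  apply: cvg_EFin; first exact: nearW.
  apply: cvgMr; apply: continuous_cvg; first exact: continuous_expR.
  apply: cvgN; apply: cvgMl; rewrite -[X in _ --> X]subr0 -[X in _ --> _ - X](mulr0 p).
  by apply: cvgB; [exact: cvg_cst|apply: cvgMr; exact: cvg_harmonic].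
move=> /cvge_to_ge; apply; apply: nearW => n /=; apply: half => //.
- by rewrite subr_ge0 ler_piMr// invf_le1// ler1n.
- by apply: lt_le_trans pl; rewrite gtrDl oppr_lt0 mulr_gt0// invr_gt0.
Unshelve. all: end_near. Qed.

Theorem theorem2p1 (R : realType) :
  (forall a gamma alpha mu0 q p A B : R,
     0 < a -> 0 < gamma + 1 -> 0 < alpha -> (gamma + 1) / alpha <= mu0 ->
     0 <= q -> 0 <= p -> 0 < B ->
     ((forall mu x : R, mu0 < mu -> 0 < x ->
         ((mathieu_bound B q gamma alpha mu x)%:E
            <= mathieu_S x a gamma alpha mu)%E /\
         (mathieu_S x a gamma alpha mu
            <= (mathieu_bound A p gamma alpha mu x)%:E)%E)
      <->
      [/\ 0 <= p, p < a `^ alpha, a `^ alpha <= q,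
          (A_ p a gamma alpha <= A%:E)%E
        & 0 < B /\ (B%:E <= B_ q a gamma alpha)%E])
     /\
     ([/\ 0 <= p, p < a `^ alpha, a `^ alpha <= q,
          (A_ p a gamma alpha <= A%:E)%E
        & 0 < B /\ (B%:E <= B_ q a gamma alpha)%E] ->
      forall mu x : R, mu0 < mu -> (0 < x \/ (0 < p /\ x = 0)) ->
        ((mathieu_bound B q gamma alpha mu x)%:E
           < mathieu_S x a gamma alpha mu)%E /\
        (mathieu_S x a gamma alpha mu
           < (mathieu_bound A p gamma alpha mu x)%:E)%E))
  /\
  (forall a gamma alpha q p : R,
     0 < a -> 0 < gamma + 1 -> 0 < alpha -> 0 <= q -> 0 <= p ->
     ((A_ p a gamma alpha < +oo)%E <-> p < a `^ alpha) /\
     ((0 < B_ q a gamma alpha)%E <-> a `^ alpha <= q))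
  /\
  (forall a : R, 1 <= a ->
     (forall p q : R, 0 <= p <= m_shift_infty a -> a ^+ 2 <= q ->
        A_ p a 1 2 = (2^-1)%:E /\ B_ q a 1 2 = (2^-1)%:E) /\
     (forall p q : R, 0 <= p <= a ^+ 2 - a -> a ^+ 2 <= q ->
        A_ p a 1 2 = (2^-1)%:E /\ B_ q a 1 2 = (2^-1)%:E)).
Proof.
split; last split.
- move=> a gamma alpha mu0 q p A B a0 g0 al0 bmu q0 p0 B0.
  (* Proved before the equivalence, whose sufficiency direction is its weakening; both cases for x
     enter only through x >= 0 and p + x > 0. *)
  have strict : [/\ 0 <= p, p < a `^ alpha, a `^ alpha <= q,
          (A_ p a gamma alpha <= A%:E)%E
        & 0 < B /\ (B%:E <= B_ q a gamma alpha)%E] ->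
      forall mu x : R, mu0 < mu -> (0 < x \/ (0 < p /\ x = 0)) ->
        ((mathieu_bound B q gamma alpha mu x)%:E
           < mathieu_S x a gamma alpha mu)%E /\
        (mathieu_S x a gamma alpha mu
           < (mathieu_bound A p gamma alpha mu x)%:E)%E.
    move=> [_ pa aq leA [_ leB]] mu x mumu hx.
    have bm := le_lt_trans bmu mumu.
    have [x0 px] : 0 <= x /\ 0 < p + x.
      case: hx => [x0|[p1 ->]]; last by rewrite addr0.
      by rewrite ltr_wpDl// ltW.
    by split; [exact: mathieu_lower_lt|exact: mathieu_upper_lt].
  split=> //; split=> [ineq|hyp mu x mumu x0]; last first.
    by have [/ltW ? /ltW ?] := strict hyp mu x mumu (or_introl x0).
  have near_ineq t : 0 < t -> \forall n \near \oo, mu0 < (n%:R : R) /\ 0 < (n%:R : R) / t.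
    move=> t0; near=> n; split; first by near: n; exact: nbhs_infty_gtr.
    by rewrite divr_gt0//; near: n; exact: nbhs_infty_gtr.
  have leA : (A_ p a gamma alpha <= A%:E)%E.
    apply/A_leP => t t0; apply: f_series_le_of_mathieu_upper => //.
    by apply: filterS (near_ineq t t0) => n [n1 n2]; have [] := ineq _ _ n1 n2.
  have leB : (B%:E <= B_ q a gamma alpha)%E.
    apply/B_geP => t t0; apply: f_series_ge_of_mathieu_lower => //.
    by apply: filterS (near_ineq t t0) => n [n1 n2]; have [] := ineq _ _ n1 n2.
  (* The ranges of the shifts follow from the constants: a finite bound on [A_] forces p < a^alpha,
     a positive one below [B_] forces a^alpha <= q. *)
  split=> //; first exact: A_le_shift_lt leA.
  exact: B_ge_shift_ge leB.
- move=> a gamma alpha q p a0 g0 al0 q0 p0; split; split.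
  + case E : (A_ p a gamma alpha) => [r| |] // _.
    * by apply: (@A_le_shift_lt R p a gamma alpha r) => //; rewrite E.
    * by apply: (@A_le_shift_lt R p a gamma alpha 0) => //; rewrite E leNye.
  + move=> pa; have [A _ leA] := A_le_EFin a0 g0 al0 p0 pa.
    exact: le_lt_trans leA (ltry _).
  + case E : (B_ q a gamma alpha) => [r| |] //.
    * by rewrite lte_fin => r0; apply: (@B_ge_shift_ge R q a gamma alpha r) => //; rewrite E.
    * by move=> _; apply: (@B_ge_shift_ge R q a gamma alpha 1) => //; rewrite E leey.
  + move=> aq; have [B B0 leB] := B_ge_EFin a0 g0 al0 q0 aq.
    by apply: lt_le_trans leB; rewrite lte_fin.
- move=> a a1; split=> p q /andP[p0 pm] aq; (split; last exact: B12_eq_half).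
  + by apply: A12_eq_half => //; exact: A12_le_half_m_shift_infty.
  + by apply: A12_eq_half => //; exact: A12_le_half.
Unshelve. all: end_near. Qed.
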